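(* Let $G$ be any connected graph and let $U \subseteq V(G)$ be any vertex set. Then exactly one of the following two assertions holds: (i) $G$ contains a dominated comb attached to $U$; (ii) $G$ has a rooted tree-decomposition $(T, \mathcal{V})$, $\mathcal{V} = (V_t)_{t \in T}$, such that: each part $V_t$ contains at most finitely many vertices from $U$; all parts at non-leaves of $T$ are finite; $(T,\mathcal{V})$ has essentially disjoint connected separators; and $(T, \mathcal{V})$ displays the ends of $G$ that lie in the closure of $U$.
   Context: Graphs may be infinite. A comb is the union of a ray $R$ (its spine) with infinitely many disjoint finite paths, possibly trivial, that have precisely their first vertex on $R$; their last vertices are the teeth. A comb attached to $U$ has all its teeth in $U$. A subdivided star (subdivision of an infinite star) dominates a comb if infinitely many of its leaves are teeth of the comb; a dominated comb in $G$ is a comb in $G$ dominated by some subdivided star in $G$. An end of $G$ is an equivalence class of rays, two rays being equivalent if no finite vertex set separates them. An end $\omega$ lies in the closure of $U$ if $G$ contains a comb attached to $U$ whose spine lies in $\omega$. For a tree-decomposition $(T,\mathcal{V})$, the separator (adhesion set) associated with an edge $t_1t_2$ of $T$ is $V_{t_1}\cap V_{t_2}$; it is connected if it induces a connected subgraph of $G$. A rooted tree-decomposition has a root $r$ of $T$ and the tree-order on $T$. If all separators are finite, every end $\omega$ of $G$ determines an orientation of each edge $t_1t_2$ of $T$: removing the edge splits $T$ into subtrees $T_1 \ni t_1$, $T_2 \ni t_2$, and the rays of $\omega$ have tails in exactly one of $\bigcup_{t \in T_i} V_t \setminus (V_{t_1}\cap V_{t_2})$; orient the edge towards that $T_i$.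 Either all edges are oriented towards a unique node $t$, and $\omega$ is said to live at $t$ (in the part $V_t$), or the orientations point towards a unique end $\eta$ of $T$, and $\omega$ corresponds to $\eta$. This defines a map $\tau$ from the ends of $G$ to $\Omega(T) \sqcup V(T)$. A tree-decomposition with finite separators displays a set $\Psi$ of ends of $G$ if $\tau$ restricts to a bijection between $\Psi$ and the set $\Omega(T)$ of ends of $T$, and every end not in $\Psi$ is mapped by $\tau$ to a node of $T$. A rooted tree-decomposition has upwards disjoint separators on an edge set $F\subseteq E(T)$ if for any two edges $e,f \in F$ with $e$ lying on the path from the root to $f$ (and $e\neq f$), the separators associated with $e$ and $f$ are disjoint. It has essentially disjoint separators if there is an edge set $F \subseteq E(T)$ meeting every ray of $T$ infinitely often such that the separators associated with the edges in $F$ are upwards disjoint (in particular, separators are required to be finite in (ii) implicitly via display). *)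

(* Defs.v *)
From HB Require Import structures.
From mathcomp Require Import all_boot.
From mathcomp Require Import boolp classical_sets functions cardinality.

Set Implicit Arguments.
Unset Strict Implicit.
Unset Printing Implicit Defensive.

Local Open Scope classical_set_scope.

(* Simple graphs, possibly infinite. *)
Record graph := Graph {
  vertex :> Type;
  adj : rel vertex;
  adj_sym : symmetric adj;
  adj_irr : irreflexive adj
}.

(* Classical decidable equality and choice, so that [seq], [uniq], [\in] and
   [path] apply to the vertices of an arbitrary graph. *)
HB.instance Definition _ (G : graph) := gen_eqMixin (vertex G).
HB.instance Definition _ (G : graph) := gen_choiceMixin (vertex G).

Section Graphs.
Variable G : graph.
Implicit Types (x y : G) (p q : seq G) (A B S X U : set G).

(* As in path.v, a path is given by its first vertex [x] and the sequence [p]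
   of its other vertices; it ends at [last x p]. *)
Definition is_path x p := path (@adj G) x p && uniq (x :: p).

(* [X] induces a connected subgraph; connected graphs are nonempty. *)
Definition connected_set X :=
  X !=set0 /\
  forall x y, X x -> X y ->
    exists p, [/\ is_path x p, last x p = y & forall z, z \in x :: p -> X z].

Definition connected_graph := connected_set [set: G].

Definition acyclic_graph :=
  forall c : seq G, 2 < size c -> ~ ucycle (@adj G) c.

Definition is_tree := connected_graph /\ acyclic_graph.

Definition edges : set (set G) :=
  [set e | exists x y, adj x y /\ e = [set x; y]].

Definition path_edges x p : set (set G) :=
  [set e | exists2 i, i < size p &
           e = [set nth x (x :: p) i; nth x (x :: p) i.+1]].

Record ray := Ray {
  ray_fun :> nat -> G;
  ray_adj : forall n, adj (ray_fun n) (ray_fun n.+1);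
  ray_inj : injective ray_fun
}.

Definition ray_edges (R : ray) : set (set G) :=
  [set e | exists n, e = [set R n; R n.+1]].

Definition has_tail_in (R : ray) X := exists N, forall n, N <= n -> X (R n).

(* Vertices of [A] and [B] may belong to the separating set [S]. *)
Definition separates S A B :=
  forall x p, is_path x p -> A x -> B (last x p) ->
    exists2 z, z \in x :: p & S z.

Definition ray_equiv (R R' : ray) :=
  ~ exists2 S, finite_set S & separates S (range R) (range R').

Definition graph_end :=
  {w : set ray | exists R, w = [set R' | ray_equiv R R']}.

Definition in_end (w : graph_end) (R : ray) : Prop := sval w R.

(* The paths attached to the spine are pairs (first vertex, other vertices). *)
Record comb := Comb {
  spine : ray;
  comb_paths : set (G * seq G);
  comb_infinite : infinite_set comb_paths;
  comb_is_path : forall xp, comb_paths xp -> is_path xp.1 xp.2;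
  comb_first : forall xp, comb_paths xp -> range spine xp.1;
  comb_others : forall xp z, comb_paths xp -> z \in xp.2 -> ~ range spine z;
  comb_disjoint : forall xp yq, comb_paths xp -> comb_paths yq -> xp <> yq ->
    forall z, z \in xp.1 :: xp.2 -> z \notin yq.1 :: yq.2
}.

Definition teeth (C : comb) : set G :=
  [set last xp.1 xp.2 | xp in comb_paths C].

Definition attached (C : comb) U := teeth C `<=` U.

(* A subdivided infinite star, given by its centre [c] and the sequences [p]
   such that [c :: p] is the path from [c] to one of the leaves. *)
Record subdivided_star := SubdividedStar {
  center : G;
  star_paths : set (seq G);
  star_infinite : infinite_set star_paths;
  star_is_path : forall p, star_paths p -> is_path center p;
  star_nontrivial : forall p, star_paths p -> p <> [::];
  star_disjoint : forall p q, star_paths p -> star_paths q -> p <> q ->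
    forall z, z \in p -> z \notin q
}.

Definition leaves (S : subdivided_star) : set G :=
  [set last (center S) p | p in star_paths S].

Definition dominates (S : subdivided_star) (C : comb) :=
  infinite_set (leaves S `&` teeth C).

Definition dominated (C : comb) := exists S : subdivided_star, dominates S C.

Definition in_closure U (w : graph_end) :=
  exists C, attached C U /\ in_end w (spine C).

(* The root of a tree is never a leaf, even if it has degree 1. *)
Definition is_leaf (r t : G) := t <> r /\ exists! s, adj t s.

Definition adj_minus (t1 t2 : G) : rel G :=
  fun x y => [&& adj x y, (x, y) != (t1, t2) & (x, y) != (t2, t1)].

(* The component containing [t1] of the graph minus the edge [t1 t2]. *)
Definition branch (t1 t2 : G) : set G :=
  [set t | exists2 p, path (adj_minus t1 t2) t1 p & last t1 p = t].

End Graphs.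

Arguments edges : clear implicits.

Section TreeDecompositions.
Variables (G T : graph) (V : T -> set G).
Implicit Types (t : T) (e f : set T) (F : set (set T)).
Implicit Types (w : graph_end G) (h : graph_end T).

Definition is_tree_decomposition :=
  [/\ is_tree T,
      forall x, exists t, V t x,
      forall x y, adj x y -> exists t, V t x /\ V t y
    & forall s p t, is_path s p -> t \in s :: p ->
        V s `&` V (last s p) `<=` V t].

(* For an edge e = {t1, t2} this is V t1 `&` V t2. *)
Definition separator e : set G := \bigcap_(t in e) V t.

Definition connected_separators :=
  forall e, edges T e -> connected_set (separator e).

Definition finite_separators :=
  forall e, edges T e -> finite_set (separator e).

Definition upwards_disjoint (r : T) F :=
  forall e f p, F e -> F f -> e <> f ->
    is_path r p -> f (last r p) -> path_edges r p e ->
    separator e `&` separator f = set0.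

Definition essentially_disjoint (r : T) :=
  exists F, [/\ F `<=` edges T,
                forall R : ray T, infinite_set (F `&` ray_edges R)
              & upwards_disjoint r F].

(* The end [w] orients the edge [t1 t2] from [t1] towards [t2]. *)
Definition oriented w t1 t2 :=
  forall R, in_end w R ->
    has_tail_in R
      ((\bigcup_(t in branch t2 t1) V t) `\` separator [set t1; t2]).

Definition lives_at w t :=
  forall t1 t2, adj t1 t2 -> branch t2 t1 t -> oriented w t1 t2.

Definition corresponds_to w h :=
  forall t1 t2, adj t1 t2 ->
    (forall R, in_end h R -> has_tail_in R (branch t2 t1)) ->
    oriented w t1 t2.

(* For a tree-decomposition with finite separators, this determines [tau]. *)
Definition is_end_map (tau : graph_end G -> graph_end T + T) :=
  forall w, match tau w with
            | inl h => corresponds_to w h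
            | inr t => lives_at w t
            end.

Definition displays (Psi : set (graph_end G)) :=
  finite_separators /\
  exists tau, [/\ is_end_map tau,
                  set_bij Psi (range inl) tau
                & forall w, ~ Psi w -> range inr (tau w)].

End TreeDecompositions.

(* Main.v *)
(** If no comb attached to [U] is dominated, a depth-first search builds the
    tree-decomposition.  A node of the tree carries a finite connected separator
    and a component behind it; as long as the component meets [U] infinitely
    often, the search moves to a neighbour of its last vertex inside the
    component and recurses into the components that remain.  The search always
    follows a path towards a target, and the targets alternate between a vertex
    of [U] and a neighbour of the lowest vertex of the current separator.  Hence
    the vertices visited along a ray of the tree form a ray [R] of [G] that is
    the spine of a comb attached to [U], and also of a comb attached to the
    neighbours of every vertex that stays lowest from some point on; such a
    vertex would dominate the first comb.  So no vertex stays lowest: cutting off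
    the low vertices without neighbours in the component, the separators along
    the ray are eventually disjoint from any finite set, and [R] represents the
    only end of [G] that follows the ray of the tree.

    Conversely, the end of a dominated comb attached to [U] would correspond to
    an end of [T], and the centre of the dominating star would lie in all
    separators sufficiently far along a ray of that end. *)

Require Import Defs.
From HB Require Import structures.
From mathcomp Require Import all_boot.
From mathcomp Require Import boolp classical_sets functions cardinality.

Set Implicit Arguments.
Unset Strict Implicit.
Unset Printing Implicit Defensive.

Local Open Scope classical_set_scope.

(** * Walks, rays and ends *)

Lemma finite_nat_bound (A : set nat) :
  finite_set A -> exists N, forall n, A n -> n < N.
Proof.
move=> /finite_seqP[s ->]; exists (\max_(i <- s) i).+1 => n /= ns.
by rewrite ltnS; apply: (@leq_bigmax_seq _ s xpredT id n).
Qed.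

(** Each point of [Y] lies in at most one member of the family. *)
Lemma disjoint_family_meets_finite (I T : Type) (P : set I) (f : I -> set T)
    (Y : set T) :
  (forall i j, P i -> P j -> i <> j -> forall z, f i z -> ~ f j z) ->
  finite_set Y -> finite_set (P `&` [set i | exists2 y, Y y & f i y]).
Proof.
move=> dis finY.
apply: (@sub_finite_set _ _ (\bigcup_(y in Y) (P `&` [set i | f i y]))).
  by move=> i [Pi [y Yy fiy]]; exists y.
apply: bigcup_finite => // y _.
have [[i [Pi fiy]]|none] := pselect (exists i, P i /\ f i y).
  apply: (@sub_finite_set _ _ [set i]) => // j [Pj fjy] /=.
  by apply: contrapT => ji; apply: (dis _ _ Pj Pi ji y).
rewrite (_ : _ `&` _ = set0) //; apply/seteqP; split => // i [Pi fiy].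
by apply: none; exists i.
Qed.

Section Walks.
Variable G : graph.
Implicit Types (X Y S A : set G) (x y z : G) (R : ray G) (w : graph_end G).

(** Walks inside [X] instead of paths: they concatenate freely, and [conn_path] shortens one to a
    path when needed. *)
Inductive conn X : G -> G -> Prop :=
| conn_refl x : X x -> conn X x x
| conn_step x y z : X x -> adj x y -> conn X y z -> conn X x z.

Lemma conn_in X x y : conn X x y -> X x /\ X y.
Proof. by elim=> [//|{}x z {}y Xx _ _ []]. Qed.

Lemma conn_trans X x y z : conn X x y -> conn X y z -> conn X x z.
Proof.
by elim=> [//|a b c Xa ab _ IH] cz; apply: (conn_step Xa ab); apply: IH.
Qed.

Lemma conn_adj X x y : X x -> X y -> adj x y -> conn X x y.
Proof. by move=> Xx Xy xy; apply: (conn_step Xx xy); apply: conn_refl. Qed.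

Lemma conn_sym X x y : conn X x y -> conn X y x.
Proof.
elim=> [a Xa|a b c Xa ab bc cb]; first exact: conn_refl.
apply: (conn_trans cb); apply: conn_adj => //; last by rewrite adj_sym.
by case: (conn_in bc).
Qed.

Lemma conn_sub X Y x y : X `<=` Y -> conn X x y -> conn Y x y.
Proof.
move=> XY; elim=> [a Xa|a b c Xa ab _ bc]; first exact/conn_refl/XY.
by apply: conn_step bc => //; apply: XY.
Qed.

Lemma conn_exit X A x y : conn X x y -> A x -> ~ A y ->
  exists a b, [/\ adj a b, X a, X b, A a & ~ A b].
Proof.
elim=> [//|a b c Xa ab bc IH Aa nAc].
have [Ab|nAb] := pselect (A b); first exact: IH.
by exists a, b; split=> //; case: (conn_in bc).
Qed.

Lemma path_conn X x p : path (@adj G) x p ->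
  (forall z, z \in x :: p -> X z) -> forall z, z \in x :: p -> conn X x z.
Proof.
elim: p x => [|y p IH] x /= => [_ sub z|/andP[xy yp] sub z].
  by rewrite inE => /eqP ->; apply: conn_refl; apply: sub; rewrite inE.
rewrite in_cons => /predU1P[->|zp].
  by apply: conn_refl; apply: sub; rewrite inE eqxx.
apply: (conn_step _ xy); first by apply: sub; rewrite inE eqxx.
by apply: IH => // t tp; apply: sub; rewrite in_cons tp orbT.
Qed.

Lemma path_conn_last X x p : path (@adj G) x p ->
  (forall z, z \in x :: p -> X z) -> conn X x (last x p).
Proof. by move=> xp sub; apply: (path_conn xp sub); apply: mem_last. Qed.

Lemma conn_path X x y : conn X x y ->
  exists p, [/\ is_path x p, last x p = y & forall z, z \in x :: p -> X z].
Proof.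
move=> xy.
have [p [xp <- sub]] : exists p, [/\ path (@adj G) x p, last x p = y &
    forall z, z \in x :: p -> X z].
  elim: xy => [a Xa|a b c Xa ab _ [p [bp bc sub]]].
    by exists [::]; split=> // z; rewrite inE => /eqP ->.
  exists (b :: p); split=> //=; first by rewrite ab.
  by move=> z; rewrite in_cons => /predU1P[->|/sub].
have [q xq uq qp] := shortenP xp; exists q; split=> //.
  by rewrite /is_path xq.
move=> z zq; apply: sub; move: zq; rewrite !in_cons => /predU1P[->|/qp ->].
  by rewrite eqxx.
by rewrite orbT.
Qed.

Lemma connected_setP X :
  X !=set0 -> (forall x y, X x -> X y -> conn X x y) -> connected_set X.
Proof. by move=> X0 cX; split=> // x y Xx Xy; apply/conn_path/cX. Qed.

Lemma connected_set_conn X x y : connected_set X -> X x -> X y -> conn X x y.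
Proof.
move=> [_ cX] Xx Xy; have [p [/andP[xp _] <- sub]] := cX _ _ Xx Xy.
exact: path_conn_last.
Qed.

Lemma not_separates S A B : ~ separates S A B <->
  exists x y, [/\ A x, B y & conn (~` S) x y].
Proof.
split=> [nsep|[x [y [Ax By xy]]] sep].
  apply: contrapT => none; apply: nsep => x p /andP[xp _] Ax Bp.
  apply: contrapT => nS; apply: none; exists x, (last x p); split=> //.
  by apply: path_conn_last => // z zp Sz; apply: nS; exists z.
have [p [xp py sub]] := conn_path xy.
have [|z /sub nSz Sz] := sep _ _ xp Ax; first by rewrite py.
exact: nSz.
Qed.

Lemma ray_equivP R R' : ray_equiv R R' <->
  forall S, finite_set S -> exists i j, conn (~` S) (R i) (R' j).
Proof.
split=> [RR S finS|RR [S finS sep]].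
  have /not_separates[_ [_ [[i _ <-] [j _ <-] ij]]] :
    ~ separates S (range R) (range R') by move=> sep; apply: RR; exists S.
  by exists i, j.
have [i [j ij]] := RR S finS; move: sep; apply/not_separates.
by exists (R i), (R' j).
Qed.

Lemma ray_avoids R S : finite_set S -> exists N, forall n, N <= n -> ~ S (R n).
Proof.
move=> finS; have /finite_nat_bound[N Nb] : finite_set (R @^-1` S).
  by apply: finite_preimage => // i j _ _; apply: (@ray_inj _ R).
by exists N => n Nn Sn; move: (Nb n Sn); rewrite ltnNge Nn.
Qed.

Lemma ray_conn R X m n :
  (forall k, m <= k <= n -> X (R k)) -> m <= n -> conn X (R m) (R n).
Proof.
elim: n => [|n IH] sub.
  by rewrite leqn0 => /eqP m0; subst m; apply/conn_refl/sub.
rewrite leq_eqVlt => /predU1P[m_n|mn].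
  by subst m; apply/conn_refl/sub; rewrite leqnn.
have Rmn : conn X (R m) (R n).
  by apply: IH => [k /andP[mk kn]|//]; apply: sub; rewrite mk leqW.
apply: (conn_trans Rmn); apply: conn_adj; last exact: ray_adj.
  by case: (conn_in Rmn).
by apply: sub; rewrite leqnn ltnW.
Qed.

Lemma ray_conn_tail R X N m n : (forall k, N <= k -> X (R k)) ->
  N <= m -> N <= n -> conn X (R m) (R n).
Proof.
move=> sub Nm Nn.
have aux a b : N <= a -> a <= b -> conn X (R a) (R b).
  by move=> Na ab; apply: ray_conn => // k /andP[/(leq_trans Na) + _]; apply: sub.
by case/orP: (leq_total m n) => mn; [|apply: conn_sym]; apply: aux.
Qed.

Lemma has_tail_sub R X Y : X `<=` Y -> has_tail_in R X -> has_tail_in R Y.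
Proof. by move=> XY [N sub]; exists N => n /sub /XY. Qed.

Lemma has_tailI R X Y :
  has_tail_in R X -> has_tail_in R Y -> has_tail_in R (X `&` Y).
Proof.
move=> [N subX] [M subY]; exists (maxn N M) => n.
by rewrite geq_max => /andP[/subX ? /subY].
Qed.

Lemma has_tail_ex R X : has_tail_in R X -> X !=set0.
Proof. by move=> [N sub]; exists (R N); apply: sub. Qed.

Lemma has_tail_compl R S : finite_set S -> has_tail_in R (~` S).
Proof. by move=> /(ray_avoids R). Qed.

(** [Y] contains the neighbourhood of [X]. With [Y] finite this is the only kind of cut against
    which rays, ends, combs and stars are tested below. *)
Definition outer_boundary X Y := forall x y, adj x y -> X x -> ~ X y -> Y y.

(** Beyond its last vertex in [Y] the ray can no longer leave [X]. *)
Lemma ray_side R X Y : finite_set Y -> outer_boundary X Y ->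
  has_tail_in R X \/ has_tail_in R (~` X).
Proof.
move=> finY bd; have [N avoid] := ray_avoids R finY.
have [[n [Nn Xn]]|none] := pselect (exists n, N <= n /\ X (R n)).
  left; exists n; elim=> [|k IH]; first by rewrite leqn0 => /eqP <-.
  rewrite leq_eqVlt => /predU1P[<- //|nk].
  apply: contrapT => nX; apply: (avoid k.+1).
    by rewrite ltnW // ltnS (leq_trans Nn).
  exact: bd (ray_adj R k) (IH nk) nX.
by right; exists N => n Nn Xn; apply: none; exists n.
Qed.

Lemma finite_initial R N : finite_set [set R n | n in `I_N].
Proof. by apply: finite_image; apply: finite_II. Qed.

(** Otherwise [R'] has a tail outside [X]. Delete [Y] and the initial segments before both tails: a
    walk that still joins the rays leaves [X] and so meets [Y]. *)
Lemma ray_equiv_side R R' X Y : finite_set Y -> outer_boundary X Y ->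
  ray_equiv R R' -> has_tail_in R X -> has_tail_in R' X.
Proof.
move=> finY bd /ray_equivP RR [N RX].
have [//|[M R'X]] := ray_side R' finY bd.
pose S := Y `|` [set R n | n in `I_N] `|` [set R' n | n in `I_M].
have [|i [j ij]] := RR S.
  by rewrite !finite_setU; do !split=> //; apply: finite_initial.
have [Si Sj] := conn_in ij.
have Ni : N <= i.
  by rewrite leqNgt; apply/negP => iN; apply: Si; left; right; exists i.
have Mj : M <= j.
  by rewrite leqNgt; apply/negP => jM; apply: Sj; right; exists j.
have [a [b [ab _ Sb Xa nXb]]] := conn_exit ij (RX _ Ni) (R'X _ Mj).
by case: Sb; left; left; apply: bd ab Xa nXb.
Qed.

Lemma ray_equiv_refl R : ray_equiv R R.
Proof.
apply/ray_equivP => S /(ray_avoids R)[N av]; exists N, N.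
by apply: conn_refl; apply: av.
Qed.

Lemma ray_equiv_sym R R' : ray_equiv R R' -> ray_equiv R' R.
Proof.
move=> /ray_equivP RR; apply/ray_equivP => S /RR[i [j ij]].
by exists j, i; apply: conn_sym.
Qed.

Lemma ray_equiv_trans R1 R2 R3 :
  ray_equiv R1 R2 -> ray_equiv R2 R3 -> ray_equiv R1 R3.
Proof.
move=> /ray_equivP E12 /ray_equivP E23; apply/ray_equivP => S finS.
(* Deleting also the part of [R2] before its tail outside [S] forces both walks to meet that tail,
   along which they are linked. *)
have [N av] := ray_avoids R2 finS.
have finS' : finite_set (S `|` [set R2 n | n in `I_N]).
  by rewrite finite_setU; split=> //; apply: finite_initial.
have sub : ~` (S `|` [set R2 n | n in `I_N]) `<=` ~` S.
  by move=> x nx Sx; apply: nx; left.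
have tail n : ~ (S `|` [set R2 n | n in `I_N]) (R2 n) -> N <= n.
  by move=> nS; rewrite leqNgt; apply/negP => nN; apply: nS; right; exists n.
have [i [j ij]] := E12 _ finS'; have [k [l kl]] := E23 _ finS'.
exists i, l; apply: conn_trans (conn_sub sub ij) _.
apply: conn_trans (conn_sub sub kl).
apply: (ray_conn_tail av); apply: tail; first by case: (conn_in ij).
by case: (conn_in kl).
Qed.

Definition end_of R : graph_end G :=
  exist _ [set R' | ray_equiv R R'] (ex_intro _ R erefl).

Lemma in_end_of R : in_end (end_of R) R.
Proof. exact: ray_equiv_refl. Qed.

Lemma in_end_equiv w R R' : in_end w R -> (in_end w R' <-> ray_equiv R R').
Proof.
case: w => W wR0; case: (wR0) => R0 defW.
rewrite /in_end /= defW => R0R; split=> [R0R'|RR'].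
  exact: ray_equiv_trans (ray_equiv_sym R0R) R0R'.
exact: ray_equiv_trans R0R RR'.
Qed.

Lemma in_end_ray_equiv w R R' : in_end w R -> in_end w R' -> ray_equiv R R'.
Proof. by move=> wR wR'; apply: (iffLR (in_end_equiv R' wR)). Qed.

Lemma graph_end_ray w : exists R, in_end w R.
Proof.
case: w => W wR; case: (wR) => R defW; exists R.
by rewrite /in_end /= defW; apply: ray_equiv_refl.
Qed.

Lemma graph_end_eq w w' R : in_end w R -> in_end w' R -> w = w'.
Proof.
move=> wR w'R; apply: eq_sig_hprop => [? ? ?|]; first exact: Prop_irrelevance.
apply/seteqP; split=> R' wR'.
  exact/(in_end_equiv _ w'R)/(in_end_equiv _ wR).
exact/(in_end_equiv _ wR)/(in_end_equiv _ w'R).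
Qed.

Lemma end_side w R R' X Y : finite_set Y -> outer_boundary X Y ->
  in_end w R -> in_end w R' -> has_tail_in R X -> has_tail_in R' X.
Proof.
move=> finY bd wR /(in_end_equiv _ wR); exact: ray_equiv_side finY bd.
Qed.

End Walks.

Arguments in_end_of {G} R.

(** * Combs, stars and edge cuts of tree-decompositions *)

Section CombsAndStars.
Variable G : graph.
Implicit Types (C : comb G) (X Y U : set G) (W : subdivided_star G).

Lemma comb_paths_meet_finite C Y : finite_set Y ->
  finite_set (comb_paths C `&`
    [set xp | exists2 y, Y y & y \in xp.1 :: xp.2]).
Proof.
move=> finY.
apply: (disjoint_family_meets_finite
  (f := fun xp : G * seq G => [set y | y \in xp.1 :: xp.2])) => //.
move=> xp yq Cxp Cyq xpyq z zxp.
by apply/negP; apply: (comb_disjoint Cxp Cyq xpyq zxp).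
Qed.

(** A path of the comb with a vertex outside [X] either starts on the initial segment of the spine
    or crosses [Y]. These are finitely many vertices, and each lies on at most one path. *)
Lemma comb_side C X Y : finite_set Y -> outer_boundary X Y ->
  has_tail_in (spine C) X ->
  finite_set (comb_paths C `&`
    [set xp | exists2 z, z \in xp.1 :: xp.2 & ~ X z]).
Proof.
move=> finY bd [N tail].
set Y' := Y `|` [set spine C n | n in `I_N].
have finY' : finite_set Y'.
  by rewrite finite_setU; split=> //; apply: finite_initial.
apply: sub_finite_set (comb_paths_meet_finite C finY').
move=> xp [Cxp [z zxp nXz]]; split=> //.
have [n _ xp1] := comb_first Cxp.
have [nN|Nn] := ltnP n N.
  by exists xp.1; [right; exists n|rewrite inE eqxx].
have Xxp : X xp.1 by rewrite -xp1; apply: tail.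
have /andP[pathxp _] := comb_is_path Cxp.
have xz := path_conn pathxp (fun z h => h) zxp.
have [a [b [ab _ bxp Xa nXb]]] := conn_exit xz Xxp nXz.
by exists b => //; left; apply: bd ab Xa nXb.
Qed.

(** All but finitely many paths of the comb have their tooth in [X], and disjoint paths have
    different teeth. *)
Lemma comb_closure C U X Y : finite_set Y -> outer_boundary X Y ->
  has_tail_in (spine C) X -> attached C U -> infinite_set (U `&` X).
Proof.
move=> finY bd tail att finUX.
apply: (comb_infinite (c := C)).
apply: sub_finite_set (_ : finite_set (_ `|` _)); last first.
  rewrite finite_setU; split; first exact: comb_side finY bd tail.
  exact: comb_paths_meet_finite finUX.
move=> xp Cxp; have [Xl|nXl] := pselect (X (last xp.1 xp.2)).
  right; split=> //; exists (last xp.1 xp.2); last exact: mem_last.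
  by split=> //; apply: att; exists xp.
by left; split=> //; exists (last xp.1 xp.2) => //; apply: mem_last.
Qed.

(** Otherwise every star path with its leaf in [X] crosses [Y] outside the centre, so there are only
    finitely many of them; and only finitely many teeth lie outside [X]. *)
Lemma dominating_center_side C W X Y : finite_set Y -> outer_boundary X Y ->
  has_tail_in (spine C) X -> dominates W C -> X (center W) \/ Y (center W).
Proof.
move=> finY bd tail dom; apply: contrapT => /not_orP[nXc nYc]; apply: dom.
have fin1 := finite_image (fun xp => last xp.1 xp.2) (comb_side finY bd tail).
have fin2 : finite_set (star_paths W `&` [set p | exists2 y, Y y & y \in p]).
  apply: (disjoint_family_meets_finite (f := fun p => [set y | y \in p])) => //.
  move=> p q Wp Wq pq z zp.
  by apply/negP; apply: (star_disjoint Wp Wq pq zp).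
apply: sub_finite_set (_ : finite_set (_ `|` _)); last first.
  rewrite finite_setU; split; first exact: fin1.
  exact: finite_image (last (center W)) fin2.
move=> u [[p Wp <-] [xp Cxp xpp]].
have [Xl|nXl] := pselect (X (last (center W) p)); last first.
  left; exists xp => //; split=> //; exists (last xp.1 xp.2).
    exact: mem_last.
  by rewrite xpp.
right; exists p => //; split=> //.
have /andP[pathp _] := star_is_path Wp.
have cl := conn_sym (path_conn_last pathp (fun z h => h)).
have [a [b [ab _ bp Xa nXb]]] := conn_exit cl Xl nXc.
have Yb : Y b by apply: bd ab Xa nXb.
exists b => //; move: bp; rewrite in_cons => /predU1P[bc|//].
by case: nYc; rewrite -bc.
Qed.

End CombsAndStars.

(** * Deleting an edge of a graph or a tree *)

Section EdgeCuts.
Variable T : graph.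
Implicit Types (s t : T) (A : set T) (R : ray T).

Lemma adj_minus_sym t1 t2 : symmetric (@adj_minus T t1 t2).
Proof.
move=> x y; rewrite /adj_minus adj_sym !xpair_eqE.
by rewrite [(y == t1) && _]andbC [(y == t2) && _]andbC [X in _ && X = _]andbC.
Qed.

Lemma adj_minus_irr t1 t2 : irreflexive (@adj_minus T t1 t2).
Proof. by move=> x; rewrite /adj_minus adj_irr. Qed.

(** Making the graph without the edge a [graph] lets branches be handled by [conn]. *)
Definition delete_edge t1 t2 : graph :=
  Graph (adj_minus_sym t1 t2) (adj_minus_irr t1 t2).

Lemma branchP t1 t2 t :
  branch t1 t2 t <-> @conn (delete_edge t1 t2) setT t1 t.
Proof.
split=> [[p t1p <-]|/conn_path[p [/andP[t1p _] lastp _]]].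
  exact: (@path_conn_last (delete_edge t1 t2)).
by exists p.
Qed.

Lemma adj_minusC t1 t2 : @adj_minus T t1 t2 = adj_minus t2 t1.
Proof.
by apply/funext => x; apply/funext => y; rewrite /adj_minus [X in _ && X]andbC.
Qed.

Lemma branchCP t1 t2 t :
  branch t2 t1 t <-> @conn (delete_edge t1 t2) setT t2 t.
Proof.
split=> [[p]|/conn_path[p [/andP[t2p _] lastp _]]].
  rewrite adj_minusC => t2p <-.
  exact: (@path_conn_last (delete_edge t1 t2)).
by exists p => //; rewrite adj_minusC.
Qed.

Lemma branch_refl t1 t2 : branch t1 t2 t1.
Proof. by exists [::]. Qed.

Lemma adj_minus_case t1 t2 x y : adj x y ->
  [\/ adj_minus t1 t2 x y, x = t1 /\ y = t2 | x = t2 /\ y = t1].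
Proof.
move=> xy; have [[-> ->]|n1] := eqVneq (x, y) (t1, t2); first by constructor 2.
have [[-> ->]|n2] := eqVneq (x, y) (t2, t1); first by constructor 3.
by constructor 1; rewrite /adj_minus xy n1 n2.
Qed.

Lemma branch_step t1 t2 x y :
  branch t1 t2 x -> adj_minus t1 t2 x y -> branch t1 t2 y.
Proof.
move=> /branchP t1x xy; apply/branchP; apply: conn_trans t1x _.
exact: conn_adj.
Qed.

Lemma branch_exit t1 t2 x y : adj x y -> branch t1 t2 x -> ~ branch t1 t2 y ->
  (x = t1 /\ y = t2) \/ (x = t2 /\ y = t1).
Proof.
move=> /(adj_minus_case t1 t2)[xy bx nby|xy _ _|xy _ _]; [|by left|by right].
by case: nby; apply: branch_step xy.
Qed.

Lemma branch_outer_boundary t1 t2 :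
  outer_boundary (branch t1 t2) [set t1; t2].
Proof.
move=> x y xy bx nby; have [[_ ->]|[_ ->]] := branch_exit xy bx nby.
  by right.
by left.
Qed.

Lemma branch_cover t1 t2 : connected_graph T ->
  forall t, branch t1 t2 t \/ branch t2 t1 t.
Proof.
move=> [_ cT] t; apply: contrapT => nt.
pose A := branch t1 t2 `|` branch t2 t1.
have t1l : conn setT t1 t.
  by have [p [/andP[t1p _] <- _]] := cT t1 t I I; apply: path_conn_last.
have At1 : A t1 by left; apply: branch_refl.
have [x [y [xy _ _ Ax nAy]]] := conn_exit (A := A) t1l At1 nt.
apply: nAy; move: Ax; rewrite /A => -[bx|bx].
  have [|nby] := pselect (branch t1 t2 y); first by left.
  have [[_ ->]|[_ ->]] := branch_exit xy bx nby.
    by right; apply: branch_refl.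
  by left; apply: branch_refl.
have [|nby] := pselect (branch t2 t1 y); first by right.
have [[_ ->]|[_ ->]] := branch_exit xy bx nby.
  by left; apply: branch_refl.
by right; apply: branch_refl.
Qed.

(** A path from [t1] to [t2] avoiding the edge would close with it to a cycle. Paths with fewer than
    three vertices are treated separately, as [acyclic_graph] speaks only of longer cycles. *)
Lemma tree_branch_edge t1 t2 : acyclic_graph T -> adj t1 t2 -> ~ branch t1 t2 t2.
Proof.
move=> acT t12 /branchP/conn_path[p [/andP[t1p up] lastp _]].
have t1p' : path (@adj T) t1 p.
  by apply: sub_path t1p => x y /andP[].
case: p => [|x [|y p]] in t1p t1p' up lastp.
- by move: t12; rewrite -[t2]lastp adj_irr.
- by move: t1p; rewrite /= /adj_minus -lastp /= !eqxx /= !andbF.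
apply: (acT [:: t1, x, y & p]) => //; apply/andP; split=> //.
suff : path (@adj T) t1 (rcons [:: x, y & p] t1) by [].
by rewrite rcons_path t1p' lastp adj_sym.
Qed.

Lemma tree_branch_disjoint t1 t2 t : acyclic_graph T -> adj t1 t2 ->
  branch t1 t2 t -> branch t2 t1 t -> False.
Proof.
move=> acT t12 /branchP t1t /branchCP t2t; apply: (tree_branch_edge acT t12).
by apply/branchP; apply: conn_trans t1t (conn_sym t2t).
Qed.

Lemma path_exit A x p : path (@adj T) x p -> A x -> ~ A (last x p) ->
  exists2 i, i < size p & [/\ adj (nth x (x :: p) i) (nth x (x :: p) i.+1),
    A (nth x (x :: p) i) & ~ A (nth x (x :: p) i.+1)].
Proof.
elim: p x => [|y p IH] x //= /andP[xy yp] Ax nAl.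
have [Ay|nAy] := pselect (A y); last by exists 0.
have [i ip [adji Ai nAi]] := IH y yp Ay nAl; exists i.+1 => //.
rewrite -[nth x _ _]/(nth x (y :: p) i) -[nth x (y :: p) i.+1]/(nth x p i).
have -> : nth x (y :: p) i = nth y (y :: p) i.
  by apply: set_nth_default; rewrite /= ltnS ltnW.
by have -> : nth x p i = nth y p i by apply: set_nth_default.
Qed.

Lemma tree_path_edge t1 t2 x p : acyclic_graph T -> adj t1 t2 -> is_path x p ->
  branch t1 t2 x -> branch t2 t1 (last x p) -> path_edges x p [set t1; t2].
Proof.
move=> acT t12 /andP[xp _] bx bl.
have nbl : ~ branch t1 t2 (last x p).
  by move=> bl'; apply: tree_branch_disjoint t12 bl' bl.
have [i ip [adji Ai nAi]] := path_exit xp bx nbl.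
exists i => //; have [[-> ->//]|[_ i1]] := branch_exit adji Ai nAi.
by case: nAi; rewrite i1; apply: branch_refl.
Qed.

Lemma conn_branch t1 t2 x : conn [set t | t <> t2] t1 x -> branch t1 t2 x.
Proof.
move=> t1x; apply/branchP.
suff aux a : conn [set t | t <> t2] a x -> @conn (delete_edge t1 t2) setT a x.
  exact: aux.
elim=> [y _|y z t Xy yz zt IH]; first exact: conn_refl.
apply: conn_step IH => //; have [Xz _] := conn_in zt.
by have [//|[_ /Xz]|[/Xy]] := adj_minus_case t1 t2 yz.
Qed.

Lemma ray_branch R n k : n < k -> branch (R n.+1) (R n) (R k).
Proof.
move=> nk; apply: conn_branch; apply: ray_conn => // j /andP[nj _] /ray_inj jn.
by move: nj; rewrite jn ltnn.
Qed.

Lemma path_edges_mem (x z : T) (p : seq T) (e : set T) :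
  path_edges x p e -> e z -> z \in x :: p.
Proof.
move=> [i ip ->] [->|->]; apply: mem_nth => //=.
by rewrite ltnS ltnW.
Qed.

(** Far out, [R n.+1] is off the path from [z] to [R 0], so that path followed by the ray leads from
    [z] to [R n] without using [R n.+1]. *)
Lemma tree_ray_branch R z : connected_graph T -> exists N, forall n, N <= n ->
  branch (R n) (R n.+1) z.
Proof.
move=> [_ cT]; have [p [/andP[zp _] lastp _]] := cT z (R 0) I I.
have [N av] := ray_avoids R (finite_seq (z :: p)).
exists N => n Nn; apply: conn_branch; apply: conn_sym.
apply: (@conn_trans _ _ _ (R 0)).
  rewrite -lastp; apply: path_conn_last => // t tp tR.
  by apply: (av n.+1); [rewrite ltnW|rewrite /= -tR].
apply: ray_conn => // k /andP[_ kn] /ray_inj kn1.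
by move: kn; rewrite kn1 ltnn.
Qed.

End EdgeCuts.

(** * Cuts given by tree edges, and why the two assertions exclude each other *)

Section Exclusive.
Variables (G T : graph) (V : T -> set G).
Hypothesis tdV : is_tree_decomposition V.

(** The tree path from [s] to [s'] uses the edge, and [x] lies in all parts along this path. *)
Lemma tree_decomposition_cut t1 t2 s s' x : adj t1 t2 ->
  branch t1 t2 s -> branch t2 t1 s' -> V s x -> V s' x ->
  separator V [set t1; t2] x.
Proof.
case: tdV => -[[_ cT] acT] _ _ td4 t12 bs bs' Vs Vs'.
have [p [sp lastp _]] := cT s s' I I.
have [|i ip eqi] := tree_path_edge acT t12 sp bs; first by rewrite lastp.
move=> t te; have tp : t \in s :: p by apply: path_edges_mem te; exists i.
by apply: (td4 _ _ _ sp tp); rewrite lastp.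
Qed.

Lemma tree_decomposition_boundary t1 t2 : adj t1 t2 ->
  outer_boundary ((\bigcup_(t in branch t2 t1) V t) `\` separator V [set t1; t2])
    (separator V [set t1; t2]).
Proof.
move=> t12 x y xy [[s bs Vs] nSx] nA.
case: (tdV) => -[cT _] _ td3 _.
have [t [Vtx Vty]] := td3 _ _ xy.
have [bt|bt] := branch_cover t1 t2 cT t.
  by case: nSx; apply: tree_decomposition_cut bt bs Vtx Vs.
by apply: contrapT => nSy; apply: nA; split=> //; exists t.
Qed.

End Exclusive.

Lemma dominated_comb_no_decomposition (G T : graph) (r : T) (V : T -> set G)
    (U : set G) (C : comb G) :
  attached C U -> dominated C -> is_tree_decomposition V ->
  essentially_disjoint V r -> displays V (in_closure U) -> False.
Proof.
move=> attC [W dom] tdV [F [FE Finf Fdis]] [finS [tau [tau_map [tau_fun _ _] _]]].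
have [w Cw] : exists w : graph_end G, in_end w (spine C).
  by exists (end_of (spine C)); apply: in_end_of.
have wU : in_closure U w by exists C.
have [h _ tauw] := tau_fun _ wU.
have corr : corresponds_to V w h by have := tau_map w; rewrite -tauw.
have [R hR] := graph_end_ray h.
case: (tdV) => -[cT acT] td2 _ _.
(* The end [w] of the spine is oriented along every edge of [R], so the spine has a tail behind the
   finite separator; the dominating centre then lies behind it or in it. *)
have center_in n : (\bigcup_(t in branch (R n.+1) (R n)) V t) (center W).
  have Rn := ray_adj R n.
  have finSn : finite_set (separator V [set R n; R n.+1]).
    by apply: finS; exists (R n), (R n.+1).
  have tail : has_tail_in R (branch (R n.+1) (R n)).
    by exists n.+1 => k; apply: ray_branch.
  have orient : oriented V w (R n) (R n.+1).
    apply: corr => // R' hR'; apply: end_side hR hR' tail; last first.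
      exact: branch_outer_boundary.
    by apply: finite_set2.
  have [[]//|Sc] := dominating_center_side finSn
    (tree_decomposition_boundary tdV Rn) (orient _ Cw) dom.
  exists (R n.+1); first exact: branch_refl.
  by apply: Sc; right.
(* From some point on, a fixed part containing the centre lies on the near side of the edges of [R],
   so the centre lies on both sides and hence in their separators. *)
have [tc Vtc] := td2 (center W).
have [N1 low1] := tree_ray_branch R tc cT.
have [N2 low2] := tree_ray_branch R r cT.
pose N := maxn N1 N2.
have center_sep n : N <= n -> separator V [set R n; R n.+1] (center W).
  rewrite geq_max => /andP[N1n _]; have [t bt Vt] := center_in n.
  exact: (tree_decomposition_cut tdV (ray_adj R n) (low1 _ N1n) bt Vtc Vt).
have F_far M : exists2 n, M <= n & F [set R n; R n.+1].
  apply: contrapT => none; apply: (Finf R).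
  apply: (@sub_finite_set _ _ [set [set R n; R n.+1] | n in `I_M]).
    move=> e [Fe [n en]]; exists n => //=; rewrite ltnNge; apply/negP => Mn.
    by apply: none; exists n => //; rewrite -en.
  by apply: finite_image; apply: finite_II.
(* Two edges of [F] far out on [R]: the first lies on the path from [r] to the second, yet both
   separators contain the centre. *)
have [n Nn Fn] := F_far N; have [m nm Fm] := F_far n.+1.
have [_ cT'] := cT.
have [p [rp lastp _]] := cT' r (R m) I I.
have : separator V [set R n; R n.+1] `&` separator V [set R m; R m.+1] = set0.
  apply: (Fdis _ _ p) => //.
  - move=> /seteqP[+ _] => /(_ (R n)) -[|/ray_inj nm'|/ray_inj nm'].
    + by left.
    + by move: nm; rewrite nm' ltnn.
    + by move: nm; rewrite nm' ltnNge leqnSn.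
  - by left.
  apply: (tree_path_edge acT (ray_adj R n) rp).
    by apply: low2; apply: leq_trans Nn; apply: leq_maxr.
  by rewrite lastp; apply: ray_branch.
move=> /seteqP[+ _] => /(_ (center W)); apply; split.
  exact: center_sep.
by apply: center_sep; rewrite ltnW // (leq_trans _ nm) // ltnS.
Qed.

(** * Trees given by a parent function *)

Lemma ray_equiv_meet (G : graph) (R R' : ray G) :
  (forall N, exists i j, N <= i /\ R i = R' j) -> ray_equiv R R'.
Proof.
move=> meet; apply/ray_equivP => S /(ray_avoids R)[N av].
have [i [j [Ni Rij]]] := meet N; exists i, j; rewrite -Rij.
by apply: conn_refl; apply: av.
Qed.

(** Leaving [A] and returning would use [b] twice, since every edge that leaves [A] starts at
    [b]. *)
Lemma is_path_stays (G : graph) (A : set G) b x p :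
  (forall y z : G, adj y z -> A y -> ~ A z -> y = b) ->
  is_path x p -> A x -> A (last x p) -> forall z, z \in x :: p -> A z.
Proof.
move=> bd /andP[xp up] Ax Al z; rewrite in_cons => /predU1P[-> //|zp].
apply: contrapT => nAz; case/splitPr: zp => p1 p2 in xp up Al.
move: xp; rewrite cat_path => /andP[xp1 /andP[p1z zp2]].
rewrite last_cat /= in Al.
have b1 : b \in x :: p1.
  have xz : conn [set t | t \in x :: rcons p1 z] x z.
    by rewrite -[in X in conn _ x X](last_rcons x p1 z); apply: path_conn_last;
      rewrite ?rcons_path ?xp1.
  have [y [t [yt Xy _ Ay nAt]]] := conn_exit xz Ax nAz.
  have yb := bd _ _ yt Ay nAt; subst y.
  move: Xy; rewrite /= -rcons_cons mem_rcons in_cons => /predU1P[bz|//].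
  by case: nAz; rewrite -bz.
have b2 : b \in z :: p2.
  have zl : conn [set t | t \in z :: p2] (last z p2) z.
    by apply: conn_sym; apply: path_conn_last.
  have [y [t [yt Xy _ Ay nAt]]] := conn_exit zl Al nAz.
  by rewrite -(bd _ _ yt Ay nAt).
move: up; rewrite -cat_cons cat_uniq => /and3P[_ /hasPn/(_ _ b2)].
by rewrite b1.
Qed.

Lemma seq_argmax (I : eqType) (f : I -> nat) (s : seq I) : s <> [::] ->
  exists2 x, x \in s & forall y, y \in s -> f y <= f x.
Proof.
elim: s => // a [|b s] IH _.
  by exists a => [|y]; rewrite inE // => /eqP ->.
have [//|x xs max] := IH; have [ax|xa] := leqP (f a) (f x).
  exists x => [|y]; first by rewrite in_cons xs orbT.
  by rewrite in_cons => /predU1P[-> //|/max].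
exists a => [|y]; first by rewrite in_cons eqxx.
by rewrite in_cons => /predU1P[-> //|/max yx]; apply: leq_trans yx (ltnW xa).
Qed.

Section ParentTree.
Variables (N : Type) (root : N) (par : N -> N) (depth : N -> nat).
Hypothesis depth_par : forall x, x <> root -> depth x = (depth (par x)).+1.

(** The value [par root] is arbitrary, so the root has to be excluded. *)
Definition child x y := y <> root /\ par y = x.

Inductive anc x : N -> Prop :=
| anc_refl : anc x x
| anc_step y : y <> root -> anc x (par y) -> anc x y.

Lemma child_depth x y : child x y -> depth y = (depth x).+1.
Proof. by move=> [y0 <-]; apply: depth_par. Qed.

Lemma child_anc x y : child x y -> anc x y.
Proof. by move=> [y0 <-]; apply: anc_step => //; apply: anc_refl. Qed.

Lemma anc_trans x y z : anc x y -> anc y z -> anc x z.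
Proof. by move=> xy; elim=> // t t0 _; apply: anc_step. Qed.

Lemma anc_depth x y : anc x y -> depth x <= depth y.
Proof. by elim=> // z z0 _ xz; rewrite (depth_par z0) leqW. Qed.

Lemma anc_depth_eq x y : anc x y -> depth y <= depth x -> x = y.
Proof.
case=> // z z0 /anc_depth xz; rewrite (depth_par z0) => zx.
by move: (leq_trans zx xz); rewrite ltnn.
Qed.

Lemma anc_antisym x y : anc x y -> anc y x -> x = y.
Proof. by move=> xy /anc_depth; apply: anc_depth_eq. Qed.

Lemma root_anc x : anc root x.
Proof.
have [n] := ubnP (depth x); elim: n x => // n IH x.
have [-> _|x0] := pselect (x = root); first exact: anc_refl.
by rewrite (depth_par x0) ltnS => /IH; apply: anc_step.
Qed.

Lemma anc_par x y : anc x y -> x <> y -> anc x (par y).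
Proof. by case. Qed.

Lemma anc_child x y : anc x y -> x <> y -> exists2 z, child x z & anc z y.
Proof.
elim=> [//|t t0 xt IH _]; have [xt'|nxt] := pselect (x = par t).
  by exists t => //; apply: anc_refl.
by have [z xz zt] := IH nxt; exists z => //; apply: anc_step.
Qed.

Definition ptree_adj : rel N := fun x y => `[< child x y \/ child y x >].

Lemma ptree_adj_sym : symmetric ptree_adj.
Proof. by move=> x y; apply/asboolP/asboolP => -[]; [right|left|right|left]. Qed.

Lemma ptree_adj_irr : irreflexive ptree_adj.
Proof.
by move=> x; apply/negbTE/asboolPn => -[] /child_depth/n_Sn.
Qed.

Definition ptree : graph := Graph ptree_adj_sym ptree_adj_irr.
Implicit Types (x y z : ptree) (X : set ptree).

Lemma ptree_adjP x y : reflect (child x y \/ child y x) (adj x y).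
Proof. exact: asboolP. Qed.

Lemma anc_conn X x y :
  (forall z, anc x z -> anc z y -> X z) -> anc x y -> conn X x y.
Proof.
move=> + xy; elim: xy => [|z z0 xz IH] sub.
  by apply: conn_refl; apply: sub; apply: anc_refl.
have zz : anc (par z) z by apply: child_anc.
have xz' : conn X x (par z).
  by apply: IH => t xt tz; apply: sub => //; apply: anc_trans tz zz.
apply: (conn_trans xz'); apply: conn_adj.
- by case: (conn_in xz').
- by apply: sub; [apply: anc_step|apply: anc_refl].
- by apply/ptree_adjP; left.
Qed.

Lemma ptree_connected : connected_graph ptree.
Proof.
apply: connected_setP => [|x y _ _]; first by exists root.
apply: conn_trans (conn_sym _) _; apply: anc_conn => //; exact: root_anc.
Qed.

(** On a cycle, both neighbours of a deepest vertex would be its parent, but they are distinct. *)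
Lemma ptree_acyclic : acyclic_graph ptree.
Proof.
move=> c c3 uc.
have [|x xc max] := @seq_argmax _ (depth : ptree -> nat) c; first by case: c c3 uc.
have [i s rotc] := rot_to xc.
have : ucycle (@adj ptree) (x :: s) by rewrite -rotc rot_ucycle.
have {}max y : y \in x :: s -> depth y <= depth x.
  by rewrite -rotc mem_rot; apply: max.
have {c3} : 2 < size (x :: s) by rewrite -rotc size_rot.
have up y : y \in x :: s -> adj x y -> y = par x.
  move=> /max yx /ptree_adjP[/child_depth xy|[]//].
  by move: yx; rewrite xy ltnn.
case: s {rotc max uc} up => [//|y s]; case/lastP: s => [//|s z] up _.
case/andP; rewrite (cycle_path x) /= last_rcons => /andP[zx /andP[xy _]].
case/and3P=> _ + _; rewrite (@mem_rcons ptree) inE negb_or => /andP[/eqP yz _].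
apply: yz; transitivity (par x); last symmetry; apply: up => //.
- by rewrite in_cons mem_head orbT.
- by rewrite !in_cons (@mem_rcons ptree) mem_head !orbT.
- by rewrite adj_sym.
Qed.

Lemma ptree_is_tree : is_tree ptree.
Proof. by split; [exact: ptree_connected|exact: ptree_acyclic]. Qed.

Lemma anc_exit x y z : adj y z -> anc x y -> ~ anc x z -> y = x /\ z = par x.
Proof.
move=> /ptree_adjP[yz|[y0 yz]] xy nxz.
  by case: nxz; apply: anc_trans xy (child_anc yz).
by case: xy y0 yz => // t _ xt t0 tz; case: nxz; rewrite -tz.
Qed.

Lemma branch_anc x y : y <> root -> branch y (par y) x <-> anc y x.
Proof.
move=> y0; split=> [/branchP yx|yx].
  apply: contrapT => nyx.
  have [a [b [ab _ _ ya nyb]]] :=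
    @conn_exit (@delete_edge ptree y (par y)) _ (anc y) _ _ yx (anc_refl y) nyx.
  case/and3P: ab => ab /negP + _; apply.
  by have [-> ->] := anc_exit ab ya nyb.
apply: conn_branch; apply: anc_conn yx => z /anc_depth + _ zy.
by rewrite zy (depth_par y0) ltnn.
Qed.

Lemma branch_not_anc x y : y <> root -> @branch ptree (par y) y x <-> ~ anc y x.
Proof.
move=> y0; have ypy : adj (par y : ptree) y by apply/ptree_adjP; left.
split=> [bx /(branch_anc _ y0)|nyx].
  exact: tree_branch_disjoint ptree_acyclic ypy bx.
have [//|bx] := @branch_cover ptree (par y) y ptree_connected x.
by case: nyx; apply/(branch_anc _ y0).
Qed.

(** Outside the subtree rooted at [z] only [par z] has a neighbour inside it, so a path with both
    ends outside never enters it. *)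
Lemma is_path_anc x p z : is_path x p -> z \in x :: p ->
  anc z x \/ anc z (last x p).
Proof.
move=> xp zp; apply: contrapT => /not_orP[nzx nzl].
apply: (@is_path_stays ptree [set y | ~ anc z y] (par z) x p _ xp nzx nzl z zp).
  move=> y t yt nzy /contrapT zt.
  by have [] := anc_exit (_ : adj t y) zt nzy; first by rewrite adj_sym.
exact: anc_refl.
Qed.

Lemma is_path_above x y p : is_path x p -> anc y x -> anc y (last x p) ->
  forall z, z \in x :: p -> anc y z.
Proof.
move=> xp; apply: (@is_path_stays ptree (anc y) y) => // z t zt yz nyt.
by have [] := anc_exit zt yz nyt.
Qed.

(** Meant for the path axiom of tree-decompositions, with [X] the nodes whose parts contain a given
    vertex. Every node of the path is an ancestor of one of its ends, and descending from that end
    to [m] one stays in [X]. *)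
Lemma is_path_subtree (m : ptree) X x p :
  X `<=` anc m -> (forall y, X y -> y <> m -> X (par y)) ->
  is_path x p -> X x -> X (last x p) -> forall z, z \in x :: p -> X z.
Proof.
move=> Xm Xpar xp Xx Xl z zp.
have mz := is_path_above xp (Xm _ Xx) (Xm _ Xl) zp.
suff down y : anc z y -> X y -> X z.
  by have [/down|/down] := is_path_anc xp zp; apply.
elim=> // t t0 zt IH Xt; have [tm|tm] := pselect (t = m).
  rewrite (anc_antisym _ mz) -?tm //; exact: anc_step.
exact/IH/Xpar.
Qed.

(** After one step to a child the ray cannot turn back, by injectivity; and depth forbids moving to
    parents forever. *)
Lemma ray_ascends (R : ray ptree) :
  exists K, forall n, K <= n -> child (R n) (R n.+1).
Proof.
have up n : child (R n) (R n.+1) -> child (R n.+1) (R n.+2).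
  move=> [_ p1]; case/ptree_adjP: (ray_adj R n.+1) => // -[_ p2].
  by move: p1; rewrite p2 => /(@ray_inj _ R)/eqP; rewrite gtn_eqF.
have [[K RK]|none] := pselect (exists n, child (R n) (R n.+1)).
  exists K; elim=> [|n IH]; first by rewrite leqn0 => /eqP <-.
  by rewrite leq_eqVlt => /predU1P[<- //|/IH /up].
have down n : depth (R n) + n = depth (R 0).
  elim: n => [|n <-]; first by rewrite addn0.
  case/ptree_adjP: (ray_adj R n) => [Rn|/child_depth ->].
    by case: none; exists n.
  by rewrite addSnnS.
by have := down (depth (R 0)).+1; rewrite addnS => /eqP;
  rewrite gtn_eqF // ltnS leq_addl.
Qed.

Section Ascending.
Variable a : nat -> ptree.
Hypothesis asc : forall n, child (a n) (a n.+1).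

Lemma asc_depth n : depth (a n) = depth (a 0) + n.
Proof.
elim: n => [|n IH]; first by rewrite addn0.
by rewrite (child_depth (asc n)) IH addnS.
Qed.

Lemma asc_anc m n : m <= n -> anc (a m) (a n).
Proof.
elim: n => [|n IH]; first by rewrite leqn0 => /eqP ->; apply: anc_refl.
rewrite leq_eqVlt => /predU1P[->|mn]; first exact: anc_refl.
exact: anc_trans (IH mn) (child_anc (asc n)).
Qed.

Lemma asc_adj n : adj (a n) (a n.+1).
Proof. by apply/ptree_adjP; left. Qed.

Lemma asc_inj : injective a.
Proof.
move=> m n mn; have := asc_depth m; rewrite mn asc_depth => /eqP.
by rewrite eqn_add2l eq_sym => /eqP.
Qed.

Definition asc_ray : ray ptree := Ray asc_adj asc_inj.

End Ascending.

End ParentTree.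

(** * The depth-first search *)

Section Components.
Variable G : graph.
Implicit Types (X C : set G) (x y z : G).

Definition is_component X C := exists2 x, X x & C = [set y | conn X x y].

Lemma component_ex X x : X x -> exists2 C, is_component X C & C x.
Proof.
move=> Xx; exists [set y | conn X x y]; first by exists x.
exact: conn_refl.
Qed.

Lemma component_sub X C : is_component X C -> C `<=` X.
Proof. by move=> [x _ ->] y xy; case: (conn_in xy). Qed.

Lemma component_closed X C x y : is_component X C -> C x -> conn X x y -> C y.
Proof. by move=> [z _ ->]; apply: conn_trans. Qed.

Lemma component_eq X C C' x :
  is_component X C -> is_component X C' -> C x -> C' x -> C = C'.
Proof.
move=> [y _ ->] [z _ ->] /= yx zx; apply/seteqP; split=> t /= xt.
  exact: conn_trans zx (conn_trans (conn_sym yx) xt).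
exact: conn_trans yx (conn_trans (conn_sym zx) xt).
Qed.

Lemma component_connected X C : is_component X C -> connected_set C.
Proof.
move=> [x Xx defC]; apply: connected_setP.
  by exists x; rewrite defC; apply: conn_refl.
have xC y : C y -> conn C x y.
  rewrite {1}defC => /conn_path[p [/andP[xp _] <- sub]].
  by apply: path_conn_last => // z zp; rewrite defC; apply: path_conn zp.
by move=> y z /xC xy /xC xz; apply: conn_trans (conn_sym xy) xz.
Qed.

(** Cuts off the longest final segment of [s] without neighbours in [C]. Vertices in the middle are
    kept even if they have no such neighbour, so a path remains a path. *)
Fixpoint trim C (s : seq G) : seq G :=
  if s is x :: s' then
    if `[< (exists2 y, C y & adj x y) \/ trim C s' <> [::] >]
    then x :: trim C s' else [::]
  else [::].

Lemma trim_take C s : exists k, trim C s = take k s.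
Proof.
elim: s => [|x s [k IH]] /=; first by exists 0.
by case: ifP => _; [exists k.+1; rewrite /= IH|exists 0].
Qed.

Lemma trim_sub C s x : x \in trim C s -> x \in s.
Proof. by have [k ->] := trim_take C s; apply: mem_take. Qed.

Lemma mem_trim C s x y : x \in s -> C y -> adj x y -> x \in trim C s.
Proof.
move=> xs Cy xy; elim: s xs => [//|z s IH].
rewrite in_cons /=; have [<- _|_ /= /IH {}IH] := eqVneq x z.
  by case: asboolP => [_|[]]; [rewrite mem_head|left; exists y].
case: asboolP => [_|[]]; first by rewrite in_cons IH orbT.
by right; case: (trim C s) IH.
Qed.

Lemma trim_last C s v : trim C s <> [::] ->
  exists2 y, C y & adj (last v (trim C s)) y.
Proof.
elim: s v => [//|x s IH] v /=; case: asboolP => [h _|//] /=.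
case E : (trim C s) h => [|z t] [h|h] //=.
- by have := IH x; rewrite E; apply.
- by have := IH x; rewrite E; apply.
Qed.

Lemma sorted_connected (s : seq G) : s <> [::] -> sorted (@adj G) s ->
  connected_set [set x | x \in s].
Proof.
case: s => [//|x p] _ /= xp; apply: connected_setP.
  by exists x; rewrite /= mem_head.
have xz := path_conn xp (fun z h => h).
by move=> y z /xz xy /xz; apply: conn_trans (conn_sym xy).
Qed.

End Components.

(** * States of the search and the tree of its nodes *)

Section Construction.
Variables (G : graph) (U : set G) (v0 : G).
Hypothesis connG : connected_graph G.

(* The separator is listed from its most recent vertex down to its lowest one.
   The plan leads from the most recent vertex (excluded) to the current target,
   which lies in [U] if the mode is [true]; in mode [false] it was a neighbour of
   the lowest vertex of the separator when the plan was made. *)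
Record state := State {
  st_sep : seq G;
  st_comp : set G;
  st_plan : seq G;
  st_mode : bool
}.

Definition target m (s : seq G) : set G :=
  if m then U else [set z | adj (last v0 s) z].

Definition plan_spec m s (C : set G) q :=
  [/\ q <> [::], path (@adj G) (head v0 s) q, forall z, z \in q -> C z, uniq q
    & target m s (last v0 q)].

Definition new_plan m s C : seq G := xget [::] [set q | plan_spec m s C q].

(** Components are disjoint, so at most one of them inherits the rest of a plan. In the others the
    search makes a new plan in the opposite mode. *)
Definition continues (st : state) (C : set G) :=
  behead (st_plan st) <> [::] /\ forall z, z \in behead (st_plan st) -> C z.

Definition next st C :=
  let s := trim C (head v0 (st_plan st) :: st_sep st) in
  if `[< continues st C >] then State s C (behead (st_plan st)) (st_mode st)
  else State s C (new_plan (~~ st_mode st) s C) (~~ st_mode st).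

(** The first plan leads to [v0], which need not lie in [U]; hence the initial mode [false]. *)
Definition state_of (l : seq (set G)) :=
  foldr (fun C st => next st C) (State [::] setT [:: v0] false) l.

(** The root is internal even if [U] is finite: it never counts as a leaf, so its part has to be
    finite. *)
Definition is_internal (l : seq (set G)) :=
  l = [::] \/ infinite_set (U `&` st_comp (state_of l)).

Fixpoint valid l :=
  if l is C :: l' then
    [/\ valid l', is_internal l'
      & is_component (st_comp (state_of l') `\ head v0 (st_plan (state_of l'))) C]
  else True.

(* A node of the tree is the list of the components entered on the way from the
   root, the latest one first. *)
Definition node := {l | valid l}.
Implicit Types (n m : node).

Definition root : node := exist _ [::] I.

Lemma valid_behead l : valid l -> valid (behead l).
Proof. by case: l => [|C l] //= []. Qed.

Definition par n : node := exist _ _ (valid_behead (svalP n)).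
Definition depth n := size (sval n).
Definition sep n := st_sep (state_of (sval n)).
Definition comp n := st_comp (state_of (sval n)).
Definition plan n := st_plan (state_of (sval n)).
Definition mode n := st_mode (state_of (sval n)).
Definition apex n := head v0 (plan n).
Definition internal n := is_internal (sval n).
Notation child := (child root par).
Notation anc := (anc root par).

Lemma node_eq n m : sval n = sval m -> n = m.
Proof. by apply: eq_sig_hprop => ? ? ?; apply: Prop_irrelevance. Qed.

Lemma depth_par n : n <> root -> depth n = (depth (par n)).+1.
Proof.
rewrite /depth /=; case: n => -[|C l] //= vl; case.
exact: node_eq.
Qed.

Notation tree := (ptree depth_par).

Lemma internal_root : internal root.
Proof. by left. Qed.

Lemma child_sval n m : child n m -> exists C, sval m = C :: sval n.
Proof.
move=> [m0 <-] /=; case: m m0 => -[|C l] vl m0 /=; last by exists C.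
by case: m0; apply: node_eq.
Qed.

Lemma next_comp st C : st_comp (next st C) = C.
Proof. by rewrite /next; case: ifP. Qed.

Lemma child_state n m : child n m ->
  state_of (sval m) = next (state_of (sval n)) (comp m).
Proof. by move=> /child_sval[C mE]; rewrite /comp mE /= next_comp. Qed.

Lemma child_valid n m : child n m ->
  internal n /\ is_component (comp n `\ apex n) (comp m).
Proof.
move=> /child_sval[C mE]; have := svalP m; rewrite /comp mE /= next_comp.
by case.
Qed.

Lemma child_internal n m : child n m -> internal n.
Proof. by move=> /child_valid[]. Qed.

Lemma child_component n m : child n m -> is_component (comp n `\ apex n) (comp m).
Proof. by move=> /child_valid[]. Qed.

Lemma child_sub n m : child n m -> comp m `<=` comp n `\ apex n.
Proof. by move=> /child_component/component_sub. Qed.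

Lemma child_ex n C : internal n -> is_component (comp n `\ apex n) C ->
  exists2 m, child n m & comp m = C.
Proof.
move=> intn compC.
have vl : valid (C :: sval n) by split=> //; apply: svalP.
exists (exist _ _ vl); last by rewrite /comp /= next_comp.
by split; [case|apply: node_eq].
Qed.

Lemma child_inj n m m' : child n m -> child n m' -> comp m = comp m' -> m = m'.
Proof.
move=> /child_sval[C mE] /child_sval[C' mE']; rewrite /comp mE mE' /=.
by rewrite !next_comp => CC'; apply: node_eq; rewrite mE mE' CC'.
Qed.

Lemma child_sep n m : child n m -> sep m = trim (comp m) (apex n :: sep n).
Proof. by rewrite /sep => /child_state ->; rewrite /next; case: ifP. Qed.

Lemma child_sep_sub n m : child n m -> {subset sep m <= apex n :: sep n}.
Proof. by move=> nm z; rewrite (child_sep nm); apply: trim_sub. Qed.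

(** The plan of [n] ends or breaks on the way to [m]. By [tooth_plan] it then avoids [comp m]
    altogether, and so can serve as a path of a comb or a piece of a star path. *)
Definition tooth n m := ~ continues (state_of (sval n)) (comp m).

Lemma child_continues n m : child n m -> ~ tooth n m ->
  plan m = behead (plan n) /\ mode m = mode n.
Proof.
rewrite /plan /mode => /child_state -> /contrapT nm.
by rewrite /next; case: asboolP.
Qed.

Lemma child_tooth n m : child n m -> tooth n m ->
  plan m = new_plan (mode m) (sep m) (comp m) /\ mode m = ~~ mode n.
Proof.
move=> nm tm; rewrite /plan /mode (child_sep nm) (child_state nm) /next.
by case: asboolP => // _; rewrite next_comp.
Qed.

Lemma anc_comp n m : anc n m -> comp m `<=` comp n.
Proof.
elim=> [//|{}m m0 _ IH] z Dz; apply: IH.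
by have [] := child_sub (conj m0 erefl) Dz.
Qed.

Lemma anc_comp_strict n m : anc n m -> n <> m ->
  internal n /\ comp m `<=` comp n `\ apex n.
Proof.
move=> nm neq; have [k nk km] := anc_child nm neq.
split; first exact: child_internal nk.
by move=> z /(anc_comp km)/(child_sub nk).
Qed.

Lemma new_plan_spec b s C y z : connected_set C -> C y -> adj (head v0 s) y ->
  C z -> target b s z -> plan_spec b s C (new_plan b s C).
Proof.
move=> [_ cC] Cy sy Cz tz; have [p [/andP[yp up] py sub]] := cC _ _ Cy Cz.
apply: (@xgetPex _ [::] [set q | plan_spec b s C q]).
by exists (y :: p); split=> //=; [rewrite sy|rewrite py].
Qed.

(** Sortedness says that the separator is a path, hence connected. By [inv_attach] the apex is
    adjacent to the top of the separator, so putting it in front gives a path again, and successive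
    apices are adjacent. *)
Record node_inv n : Prop := NodeInv {
  inv_conn : connected_set (comp n);
  inv_boundary : outer_boundary (comp n) [set z | z \in sep n];
  inv_disjoint : forall z, z \in sep n -> ~ comp n z;
  inv_sorted : sorted (@adj G) (sep n);
  inv_top : n <> root -> sep n <> [::];
  inv_plan : internal n ->
    [/\ plan n <> [::], sorted (@adj G) (plan n),
        forall z, z \in plan n -> comp n z, uniq (plan n)
      & mode n -> U (last v0 (plan n))];
  inv_attach : internal n -> sep n <> [::] ->
    path (@adj G) (head v0 (sep n)) (plan n)
}.

Lemma inv_apex n : node_inv n -> internal n -> comp n (apex n).
Proof.
move=> /inv_plan + intn => /(_ intn)[]; rewrite /apex.
by case: (plan n) => // x q _ _ + _ _; apply; apply: mem_head.
Qed.

Lemma inv_step n m : child n m -> node_inv n ->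
  [/\ node_inv m, head v0 (sep m) = apex n
    & internal m -> tooth n m -> target (mode m) (sep m) (last v0 (plan m))].
Proof.
move=> nm inv_n; have [intn compm] := child_valid nm.
have Dx := inv_apex inv_n intn.
have conn_m := component_connected compm.
have sub_m := child_sub nm.
have [[c Dc] _] := conn_m.
(* A walk in the connected set [comp n] from [comp m] to the apex can leave [comp m] only into the
   apex. So the apex has a neighbour in [comp m] and survives the trimming. *)
have [y Dy xy] : exists2 y, comp m y & adj (apex n) y.
  have cx := connected_set_conn (inv_conn inv_n) (proj1 (sub_m _ Dc)) Dx.
  have nDx : ~ comp m (apex n) by move=> /sub_m[_]; apply.
  have [a [b [ab Da Db Ma nMb]]] := conn_exit cx Dc nDx.
  have [<-|bx] := pselect (b = apex n); first by exists a; rewrite // adj_sym.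
  case: nMb; apply: (component_closed compm Ma); apply: conn_adj => //.
  exact: sub_m.
have sepE := child_sep nm.
have x_in : apex n \in sep m by rewrite sepE; apply: mem_trim xy; rewrite ?mem_head.
have sep_m0 : sep m <> [::] by move=> s0; rewrite s0 in x_in.
have headE : head v0 (sep m) = apex n.
  by move: sep_m0; rewrite sepE /=; case: ifP.
have low : exists2 z, comp m z & adj (last v0 (sep m)) z.
  by move: sep_m0; rewrite sepE; apply: trim_last.
have sepP z : z \in sep m -> z = apex n \/ z \in sep n.
  by rewrite sepE => /trim_sub; rewrite in_cons => /predU1P.
have [plan0 sorted_n Dplan uplan Uplan] := inv_plan inv_n intn.
have planE : plan n = apex n :: behead (plan n).
  by rewrite /apex; case: (plan n) plan0.
have path_n : path (@adj G) (apex n) (behead (plan n)).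
  by move: sorted_n; rewrite planE.
have m0 : m <> root by case: nm.
have fresh : internal m -> tooth n m ->
    plan_spec (mode m) (sep m) (comp m) (plan m).
  move=> [ml0|infm] tm; first by case: m0; apply: node_eq.
  have [-> _] := child_tooth nm tm.
  (* A target exists in either mode: [comp m] contains vertices of [U] as [m] is internal, and
     neighbours of the lowest vertex because of the trimming. *)
  have [z Dz tz] : exists2 z, comp m z & target (mode m) (sep m) z.
    rewrite /target; case: (mode m) => //.
    by have [z [Uz Dz]] := infinite_setN0 infm; exists z.
  by apply: new_plan_spec conn_m Dy _ Dz tz; rewrite headE.
split=> //; last by move=> intm tm; have [] := fresh intm tm.
split=> //.
- move=> a b ab Da nDb.
  suff bs : b \in apex n :: sep n.
    by rewrite /= sepE; apply: mem_trim bs Da _; rewrite adj_sym.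
  rewrite in_cons; apply/predU1P.
  have [->|bx] := pselect (b = apex n); first by left.
  have [Da' _] := sub_m _ Da.
  right; apply: (inv_boundary inv_n ab Da') => Db; case: nDb.
  apply: (component_closed compm Da); apply: conn_adj => //.
  exact: sub_m.
- move=> z /sepP[-> /sub_m[_]|zs /sub_m[Dz _]]; first by apply.
  exact: (inv_disjoint inv_n zs).
- rewrite sepE; have [k ->] := trim_take (comp m) (apex n :: sep n).
  apply: take_sorted; case E : (sep n) => [//|a s].
  apply/andP; split; last by have := inv_sorted inv_n; rewrite E.
  have := inv_attach inv_n intn; rewrite E planE => /(_ _)[] //= /andP[ax _].
  by rewrite adj_sym.
- move=> intm; have [tm|ntm] := pselect (tooth n m).
    have [p0 pp Dp up tp] := fresh intm tm; split=> //.
      by case: (plan m) pp => //= a q /andP[].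
    by move: tp; rewrite /target; case: (mode m).
  have [pE mE] := child_continues nm ntm.
  move/contrapT: ntm => [q0 Dq]; rewrite pE mE; split=> //.
  + exact: path_sorted path_n.
  + by move: uplan; rewrite {1}planE => /andP[].
  by move=> /Uplan; rewrite {1}planE /=; move: q0; rewrite /plan; case: behead.
- move=> intm _; have [tm|ntm] := pselect (tooth n m).
    by have [] := fresh intm tm.
  by have [-> _] := child_continues nm ntm; rewrite headE.
Qed.

Lemma inv_root : node_inv root.
Proof.
by split.
Qed.

Lemma nodeP n : node_inv n.
Proof.
have := root_anc depth_par n; elim=> [|m m0 _ inv_m]; first exact: inv_root.
by have [] := inv_step (conj m0 erefl) inv_m.
Qed.

Lemma child_top n m : child n m -> head v0 (sep m) = apex n.
Proof. by move=> nm; have [] := inv_step nm (nodeP n). Qed.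

Lemma child_target n m : child n m -> internal m -> tooth n m ->
  target (mode m) (sep m) (last v0 (plan m)).
Proof. by move=> nm; have [] := inv_step nm (nodeP n). Qed.

Lemma comp_apex n : internal n -> comp n (apex n).
Proof. exact: inv_apex (nodeP n). Qed.

Lemma plan_cons n : internal n -> plan n = apex n :: behead (plan n).
Proof. by move=> /(inv_plan (nodeP n))[]; rewrite /apex; case: (plan n). Qed.

Lemma plan_path n : internal n -> is_path (apex n) (behead (plan n)).
Proof.
move=> intn; have [_ + _ + _] := inv_plan (nodeP n) intn.
by rewrite (plan_cons intn) /= /is_path => -> /= ->.
Qed.

Lemma plan_comp n z : internal n -> z \in plan n -> comp n z.
Proof. by move=> /(inv_plan (nodeP n))[_ _ + _ _]; apply. Qed.

(** Without the apex the plan is still connected inside [comp n]. If it met the component [comp m],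
    it would lie in it entirely and would be continued. *)
Lemma tooth_plan n m z : child n m -> tooth n m -> z \in plan n -> ~ comp m z.
Proof.
move=> nm tm; have [intn compm] := child_valid nm.
have /andP[path_n uniq_n] := plan_path intn.
rewrite (plan_cons intn) in_cons => /predU1P[-> /(child_sub nm)[_]|zq Dz].
  by apply.
apply: tm; split=> [q0|y yq].
  by move: zq; rewrite [behead _]q0.
have sub t : t \in behead (plan n) -> (comp n `\ apex n) t.
  move=> tq; split.
    by apply: plan_comp => //; rewrite (plan_cons intn) in_cons tq orbT.
  by move=> tx; move: uniq_n; rewrite /= -tx tq.
change (is_true (y \in behead (plan n))) in yq.
case: (behead (plan n)) path_n sub zq yq => [//|a q] /= /andP[_ aq] sub zq yq.
have aconn := path_conn aq sub; apply: (component_closed compm Dz).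
exact: conn_trans (conn_sym (aconn _ zq)) (aconn _ yq).
Qed.

(** By induction the parents agree, and components of the same set that share [z] are equal. This
    makes the sets [comp n] laminar. *)
Lemma same_depth n m z : depth n = depth m -> comp n z -> comp m z -> n = m.
Proof.
have [k] := ubnP (depth n); elim: k n m => // k IH n m nk nm Dn Dm.
have [n0|n0] := pselect (n = root).
  apply: node_eq; rewrite n0; move: nm; rewrite n0 /depth /=.
  by case: (sval m).
have [m0|m0] := pselect (m = root).
  by move: nm; rewrite (depth_par n0) m0.
have cn : child (par n) n by []; have cm : child (par m) m by [].
move: nk nm; rewrite (depth_par n0) (depth_par m0) ltnS => nk [nm].
have pE : par n = par m.
  by apply: IH; rewrite ?nk //; [case: (child_sub cn Dn)|case: (child_sub cm Dm)].
rewrite -pE in cm; apply: (child_inj cn cm).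
exact: component_eq (child_component cn) (child_component cm) Dn Dm.
Qed.

Lemma anc_at_depth n d : d <= depth n -> exists2 m, anc m n & depth m = d.
Proof.
have := root_anc depth_par n; elim=> [|{}n n0 _ IH].
  by rewrite leqn0 => /eqP ->; exists root => //; apply: anc_refl.
rewrite (depth_par n0) leq_eqVlt => /predU1P[->|].
  by exists n; [apply: anc_refl|apply: depth_par].
by rewrite ltnS => /IH[m mn md]; exists m => //; apply: anc_step.
Qed.

Lemma comp_laminar n m z : comp n z -> comp m z -> anc n m \/ anc m n.
Proof.
have aux n' m' : depth n' <= depth m' -> comp n' z -> comp m' z -> anc n' m'.
  move=> /anc_at_depth[k km kd] Dn Dm.
  by rewrite (same_depth (esym kd) Dn) //; apply: anc_comp km _ Dm.
by move=> Dn Dm; case/orP: (leq_total (depth n) (depth m)) => d;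
  [left|right]; apply: aux.
Qed.

Lemma exists_ascending (Q : node -> Prop) :
  Q root -> (forall n, Q n -> exists2 m, child n m & Q m) ->
  exists a : nat -> tree, (forall k, child (a k) (a k.+1)) /\ forall k, Q (a k).
Proof.
move=> Q0 Qstep.
have /choice[f fP] n : exists m, Q n -> child n m /\ Q m.
  have [/Qstep[m nm Qm]|nQ] := pselect (Q n); first by exists m.
  by exists n.
have Qit k : Q (iter k f root) by elim: k => [//|k /fP[]].
by exists (fun k => iter k f root); split=> // k; have [] := fP _ (Qit k).
Qed.

(** * Along a ray of the tree: the apex ray, its comb and a dominating star *)

Section Ascending.
Variable a : nat -> tree.
Hypothesis asc : forall k, child (a k) (a k.+1).

Lemma asc_internal k : internal (a k).
Proof. exact: child_internal (asc k). Qed.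

Lemma asc_comp k l : k <= l -> comp (a l) `<=` comp (a k).
Proof. by move=> /(asc_anc asc); apply: anc_comp. Qed.

Lemma asc_apex_comp k l : l <= k -> comp (a l) (apex (a k)).
Proof. by move=> lk; apply: (asc_comp lk); apply/comp_apex/asc_internal. Qed.

Lemma asc_apex_notin k l : k < l -> ~ comp (a l) (apex (a k)).
Proof. by move=> kl /(asc_comp kl)/(child_sub (asc k))[_]; apply. Qed.

Lemma asc_apex_adj k : adj (apex (a k)) (apex (a k.+1)).
Proof.
have intk := asc_internal k.+1.
have top : sep (a k.+1) <> [::].
  by apply: inv_top (nodeP _) _; case: (asc k).
have := inv_attach (nodeP _) intk top.
by rewrite (child_top (asc k)) (plan_cons intk) => /andP[].
Qed.

Lemma asc_apex_inj : injective (fun k => apex (a k)).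
Proof.
move=> k l /= kl; apply/eqP; rewrite eqn_leq; apply/andP; split;
  rewrite leqNgt; apply/negP => lt.
  by apply: (asc_apex_notin lt); rewrite -kl; apply: asc_apex_comp.
by apply: (asc_apex_notin lt); rewrite kl; apply: asc_apex_comp.
Qed.

Definition apex_ray : ray G := Ray asc_apex_adj asc_apex_inj.

Lemma apex_ray_tail k : has_tail_in apex_ray (comp (a k)).
Proof. by exists k => l; apply: asc_apex_comp. Qed.

(** What the search leaves behind between steps [k] and [l]. Paths of combs and stars are kept
    disjoint by placing them in successive layers. *)
Definition layer k l : set G := comp (a k) `\` comp (a l).

Lemma layer_sub k k' l l' : k <= k' -> l' <= l -> layer k' l' `<=` layer k l.
Proof.
by move=> kk ll z [Dk nDl]; split; [apply: asc_comp Dk|move=> /(asc_comp ll)].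
Qed.

Lemma layer_apart k l k' l' z : l <= k' -> layer k l z -> ~ layer k' l' z.
Proof. by move=> lk [_ nDl] [/(asc_comp lk)]. Qed.

Definition toothed k := tooth (a k) (a k.+1).

Lemma toothed_layer k z : toothed k -> z \in plan (a k) -> layer k k.+1 z.
Proof.
move=> tk zp; split; last exact: tooth_plan (asc k) tk zp.
exact: plan_comp (asc_internal k) zp.
Qed.

(** A plan that is continued loses its first vertex and keeps its target, so it is abandoned after
    finitely many steps. *)
Lemma next_toothed k : exists l, [/\ k <= l, toothed l, mode (a l) = mode (a k)
  & last v0 (plan (a l)) = last v0 (plan (a k))].
Proof.
have [d] := ubnP (size (plan (a k))); elim: d k => // d IH k sz.
have [tk|ntk] := pselect (toothed k); first by exists k.
have [pE mE] := child_continues (asc k) ntk.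
have [|l [kl tl ml ll]] := IH k.+1.
  by move: sz; rewrite pE (plan_cons (asc_internal k)) /= ltnS.
exists l; split=> //; [exact: ltnW|by rewrite ml mE|rewrite ll pE].
move/contrapT: ntk => [q0 _]; rewrite [in RHS](plan_cons (asc_internal k)) /=.
by move: q0; rewrite -/(plan (a k)); case: (behead _).
Qed.

Lemma toothed_target k : toothed k ->
  mode (a k.+1) = ~~ mode (a k) /\
  target (mode (a k.+1)) (sep (a k.+1)) (last v0 (plan (a k.+1))).
Proof.
move=> tk; have [_ mE] := child_tooth (asc k) tk; split=> //.
exact: child_target (asc k) (asc_internal k.+1) tk.
Qed.

(** The first tooth after [k] may belong to a plan made before [k] and is skipped. The next two
    plans are made later and have different modes, so one has mode [b]; [j] is the step at which it
    is made. *)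
Lemma fresh_tooth k b : exists j l, [/\ k <= j, j <= l, toothed l,
  mode (a l) = b & target b (sep (a j)) (last v0 (plan (a l)))].
Proof.
have fresh j : toothed j -> exists l, [/\ j < l, toothed l,
    mode (a l) = ~~ mode (a j) &
    target (~~ mode (a j)) (sep (a j.+1)) (last v0 (plan (a l)))].
  move=> /toothed_target[mE tg]; have [l [jl tl ml ll]] := next_toothed j.+1.
  by exists l; rewrite ml ll -mE.
have [j [kj tj _ _]] := next_toothed k.
have [l [jl tl ml tgl]] := fresh j tj.
have [bE|nb] := eqVneq b (~~ mode (a j)).
  by exists j.+1, l; rewrite ml bE; split=> //; apply: leqW.
have [l' [ll tl' ml' tgl']] := fresh l tl.
have bE : b = ~~ mode (a l) by rewrite ml; case: (b) (mode _) nb => -[].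
exists l.+1, l'; rewrite ml' bE; split=> //.
exact: leqW (leq_trans kj (ltnW jl)).
Qed.

Lemma plan_last k : last v0 (plan (a k)) = last (apex (a k)) (behead (plan (a k))).
Proof. by rewrite {1}(plan_cons (asc_internal k)). Qed.

Definition asc_comb_paths : set (G * seq G) :=
  [set xp | exists k, [/\ toothed k, mode (a k)
    & xp = (apex (a k), behead (plan (a k)))]].

Lemma asc_comb_infinite : infinite_set asc_comb_paths.
Proof.
move=> /(finite_image fst)/(ray_avoids apex_ray)[N av].
have [j [l [Nj jl tl ml _]]] := fresh_tooth N true.
apply: (av l); first exact: leq_trans jl.
by exists (apex (a l), behead (plan (a l))) => //; exists l.
Qed.

Lemma asc_comb_is_path xp : asc_comb_paths xp -> is_path xp.1 xp.2.
Proof. by move=> [k [_ _ ->]]; apply/plan_path/asc_internal. Qed.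

Lemma asc_comb_first xp : asc_comb_paths xp -> range apex_ray xp.1.
Proof. by move=> [k [_ _ ->]]; exists k. Qed.

Lemma asc_comb_layer xp : asc_comb_paths xp ->
  exists k, xp = (apex (a k), behead (plan (a k))) /\
    forall z, z \in xp.1 :: xp.2 -> layer k k.+1 z.
Proof.
move=> [k [tk _ ->]]; exists k; split=> // z /=.
by rewrite -(plan_cons (asc_internal k)); apply: toothed_layer.
Qed.

Lemma asc_comb_others xp z : asc_comb_paths xp -> z \in xp.2 ->
  ~ range apex_ray z.
Proof.
move=> cxp zp [j _ xz]; have /andP[_] := asc_comb_is_path cxp.
have [k [xpE lay]] := asc_comb_layer cxp.
have [Dk nDk] := lay z (mem_behead (s := _ :: _) zp).
have [jk|kj|jk] := ltngtP j k.
- by case: (asc_apex_notin jk); rewrite /= in xz; rewrite xz.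
- by case: nDk; rewrite -xz; apply: asc_apex_comp.
by move: zp; rewrite xpE -xz /= jk => ->.
Qed.

Lemma layer_inj k l z : layer k k.+1 z -> layer l l.+1 z -> k = l.
Proof.
move=> lk ll; have [kl|lk'|//] := ltngtP k l.
  by case: (layer_apart kl lk ll).
by case: (layer_apart lk' ll lk).
Qed.

Lemma asc_comb_disjoint xp yq : asc_comb_paths xp -> asc_comb_paths yq ->
  xp <> yq -> forall z, z \in xp.1 :: xp.2 -> z \notin yq.1 :: yq.2.
Proof.
move=> /asc_comb_layer[k [xpE layx]] /asc_comb_layer[l [yqE layy]] neq z zx.
apply/negP => zy; apply: neq.
by rewrite xpE yqE (layer_inj (layx z zx) (layy z zy)).
Qed.

Definition asc_comb : comb G := Comb asc_comb_infinite asc_comb_is_path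
  asc_comb_first asc_comb_others asc_comb_disjoint.

Lemma asc_comb_attached : attached asc_comb U.
Proof.
move=> _ [_ [k [tk mk ->]] <-] /=; rewrite -plan_last.
by have [_ _ _ _] := inv_plan (nodeP (a k)) (asc_internal k); apply.
Qed.

Lemma asc_comb_tooth k : toothed k -> mode (a k) ->
  teeth asc_comb (last v0 (plan (a k))).
Proof.
by move=> tk mk; rewrite plan_last; exists (apex (a k), behead (plan (a k))) => //;
  exists k.
Qed.

Lemma toothed_conn k l : toothed k -> k < l ->
  conn (layer k l) (apex (a k)) (last v0 (plan (a k))).
Proof.
move=> tk kl; rewrite plan_last; have /andP[pp _] := plan_path (asc_internal k).
apply: path_conn_last => // z; rewrite -(plan_cons (asc_internal k)) => zp.
exact: layer_sub (leqnn k) kl _ (toothed_layer tk zp).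
Qed.

Section ConstantLowest.
Variable v : G.
Hypothesis sep_nonempty : forall k, sep (a k) <> [::].
Hypothesis lowest : forall k, last v0 (sep (a k)) = v.

Lemma lowest_notin k : ~ comp (a k) v.
Proof.
apply: (inv_disjoint (nodeP _)); rewrite -(lowest k).
by have := @sep_nonempty k; case: (sep (a k)) => //= x s _; apply: mem_last.
Qed.

(** From [v] to the target of a [false] plan, which is a neighbour of [v]; back along this plan to
    its apex, along the apex ray to the start of a later [true] plan, and along that to its tooth.
    The second component of [pl] is a step by which all this has been left behind. *)
Lemma star_path N : exists pl : seq G * nat, [/\ is_path v pl.1,
  forall z, z \in pl.1 -> layer N pl.2 z, pl.1 <> [::]
  & teeth asc_comb (last v pl.1)].
Proof.
have [j [k [Nj jk tk _ tgk]]] := fresh_tooth N false.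
have [j' [l [kj jl tl ml _]]] := fresh_tooth k.+1 true.
have kl : k < l := leq_trans kj jl.
have Nk : N <= k := leq_trans Nj jk.
have sub i : k <= i <= l -> layer N l.+1 (apex (a i)).
  move=> /andP[ki il]; split; first exact/asc_apex_comp/(leq_trans Nk).
  by apply: asc_apex_notin; rewrite ltnS.
have wu : conn (layer N l.+1) (last v0 (plan (a k))) (last v0 (plan (a l))).
  apply: (@conn_trans _ _ _ (apex (a k))).
    apply: conn_sub (conn_sym (toothed_conn tk (leqnn k.+1))).
    by apply: layer_sub => //; apply: leqW.
  apply: (@conn_trans _ _ _ (apex (a l))).
    exact: (@ray_conn _ apex_ray _ k l sub (ltnW kl)).
  apply: conn_sub (toothed_conn tl (leqnn l.+1)).
  by apply: layer_sub => //; apply: leq_trans Nk (ltnW kl).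
move: tgk; rewrite /target lowest /= => vw.
have vu : conn (v |` layer N l.+1) v (last v0 (plan (a l))).
  apply: (conn_step _ vw); first by left.
  by apply: conn_sub wu => z lz; right.
have [p [vp pl sub_p]] := conn_path vu.
exists (p, l.+1); split=> //=.
- move=> z zp; have [zv|//] : (v |` layer N l.+1) z.
    by apply: sub_p; rewrite in_cons zp orbT.
  by move: vp; rewrite /is_path /= -zv zp andbF.
- move=> p0; apply: (@lowest_notin l); rewrite -[v]/(last v [::]) -p0 pl.
  rewrite plan_last; apply: plan_comp; first exact: asc_internal.
  by rewrite (plan_cons (asc_internal l)) mem_last.
by rewrite pl; apply: asc_comb_tooth.
Qed.

Lemma asc_comb_dominated : dominated asc_comb.
Proof.
have [f fP] := choice star_path.
pose N i := iter i (fun k => (f k).2) 0.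
pose p i := (f (N i)).1.
have lay i z : z \in p i -> layer (N i) (N i.+1) z by have [_ + _ _] := fP (N i); apply.
have p0 i : p i <> [::] by have [] := fP (N i).
have inj i j z : z \in p i -> z \in p j -> i = j.
  (* Each path is nonempty and lies in [layer (N i) (N i.+1)], which therefore contains a vertex;
     this forces the bounds to be monotone. *)
  have mono i' d : N i' <= N (i' + d).
    elim: d => [|d IH]; first by rewrite addn0.
    apply: (leq_trans IH); rewrite addnS.
    case E : (p (i' + d)) (p0 (i' + d)) => [//|y q] _.
    have [Dy nDy] : layer (N (i' + d)) (N (i' + d).+1) y.
      by apply: lay; rewrite E mem_head.
    rewrite leqNgt; apply/negP => lt; apply: nDy.
    exact: asc_comp (ltnW lt) _ Dy.
  have lt i' j' : i' < j' -> z \in p i' -> z \in p j' -> False.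
    move=> ij /lay li /lay; apply: layer_apart li.
    by rewrite -(subnKC ij); apply: mono.
  by move=> zi zj; have [ij|ji|//] := ltngtP i j; [case: (lt i j)|case: (lt j i)].
have last_in i : last v (p i) \in p i.
  by case: (p i) (p0 i) => //= y q _; apply: mem_last.
have inf (T : Type) (g : nat -> T) (A : set T) :
    injective g -> (forall i, A (g i)) -> infinite_set A.
  move=> ginj Ag /(finite_preimage (f := g)) fin; apply: infinite_nat.
  rewrite (_ : setT = g @^-1` A); last by apply/seteqP; split=> i // _; apply: Ag.
  by apply: fin => i j _ _; apply: ginj.
have Winf : infinite_set (range p).
  apply: (inf _ p) => [i j pij|i]; last by exists i.
  by apply: (inj i j _ (last_in i)); rewrite -pij.
have Wpath q : range p q -> is_path v q by move=> [i _ <-]; have [] := fP (N i).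
have W0 q : range p q -> q <> [::] by move=> [i _ <-]; apply: p0.
have Wdis q q' : range p q -> range p q' -> q <> q' ->
    forall z, z \in q -> z \notin q'.
  move=> [i _ <-] [j _ <-] pij z zi; apply/negP => zj; apply: pij.
  by rewrite (inj i j z zi zj).
exists (SubdividedStar Winf Wpath W0 Wdis).
apply: (inf _ (fun i => last v (p i))) => [i j /= lij|i].
  by apply: (inj i j _ (last_in i)); rewrite lij.
split; first by exists (p i) => //; exists i.
by have [] := fP (N i).
Qed.

End ConstantLowest.

End Ascending.

Hypothesis no_dominated_comb : ~ exists C : comb G, attached C U /\ dominated C.

(** * Separators along a ray of the tree leave every finite set *)

Section SeparatorForm.
Variable a : nat -> tree.
Hypothesis asc : forall k, child (a k) (a k.+1).

Lemma asc_shift j : forall k, child (a (j + k)) (a (j + k.+1)).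
Proof. by move=> k; rewrite addnS. Qed.

(** Otherwise the lowest vertex dominates [asc_comb], which is attached to [U]. *)
Lemma lowest_changes : sep (a 0) <> [::] ->
  exists k, last v0 (sep (a k)) <> last v0 (sep (a 0)).
Proof.
move=> s0; apply: contrapT => none; apply: no_dominated_comb.
have nonempty k : sep (a k) <> [::].
  by case: k => [//|k]; apply: inv_top (nodeP _) _; case: (asc k).
exists (asc_comb asc); split; first exact: asc_comb_attached.
apply: (@asc_comb_dominated a asc (last v0 (sep (a 0))) nonempty) => k.
by apply: contrapT => lk; apply: none; exists k.
Qed.

(* Trimming removes vertices only at the low end, so each later separator is a
   sequence of new vertices followed by an initial segment of the first one. *)
Definition sep_form k j := exists pre,
  sep (a k) = pre ++ take j (sep (a 0)) /\ forall z, z \in pre -> comp (a 0) z.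

Lemma sep_form_next k j : sep_form k j -> exists2 j', j' <= j & sep_form k.+1 j'.
Proof.
move=> [pre [sE preD]].
have [i iE] := trim_take (comp (a k.+1)) (apex (a k) :: sep (a k)).
have {}iE : sep (a k.+1) = take i ((apex (a k) :: pre) ++ take j (sep (a 0))).
  by rewrite (child_sep (asc k)) iE sE.
have preD' z : z \in apex (a k) :: pre -> comp (a 0) z.
  rewrite in_cons => /predU1P[->|/preD //].
  exact: asc_apex_comp.
rewrite take_cat in iE; case: ifP iE => _ iE.
  exists 0 => //; exists (take i (apex (a k) :: pre)).
  by rewrite take0 cats0; split=> // z /mem_take/preD'.
exists (minn (i - size (apex (a k) :: pre)) j); first exact: geq_minr.
by exists (apex (a k) :: pre); rewrite take_min.
Qed.

End SeparatorForm.

(** While [j] is positive, the lowest vertex of the separator is the last vertex of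
    [take j (sep (a 0))]. It has to change at some point, which makes [j] drop. *)
Lemma sep_form_zero (a : nat -> tree) (asc : forall k, child (a k) (a k.+1)) j k :
  sep_form a k j -> exists2 l, k <= l & sep_form a l 0.
Proof.
have [s0|s0] := pselect (sep (a 0) = [::]).
  by move=> [pre [kE preD]]; exists k => //; exists pre; rewrite s0 in kE *.
have [d] := ubnP j; elim: d j k => // d IH j k jd kj.
have [j0|j0] := posnP j; first by exists k => //; rewrite -j0.
have sk : sep (a (k + 0)) <> [::].
  rewrite addn0; have [pre [-> _]] := kj.
  by case: (sep (a 0)) s0 j0 => // x s _; case: j {kj jd} => // j _; case: pre.
have [i li] := lowest_changes (asc_shift asc k) sk.
have forms l : exists2 j', j' <= j & sep_form a (k + l) j'.
  elim: l => [|l [j' j'j /(sep_form_next asc)[j'' jj form]]].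
    by exists j; rewrite ?addn0.
  by exists j''; [apply: leq_trans jj j'j|rewrite addnS].
have [j' j'j form] := forms i.
have [jE|nj] := eqVneq j' j.
  case: li; rewrite addn0; have [[p [-> _]] [p' [-> _]]] := (form, kj).
  rewrite jE; case: (sep (a 0)) s0 j0 => // x s _; case: (j) => // i' _ /=.
  by rewrite !last_cat.
have [|l kl f0] := IH j' (k + i) _ form.
  by move: jd; rewrite ltnS; apply: leq_trans; rewrite ltn_neqAle nj.
by exists l => //; apply: leq_trans (leq_addr _ _) kl.
Qed.

Lemma sep_drops (a : nat -> tree) (asc : forall k, child (a k) (a k.+1)) :
  exists k, forall z, z \in sep (a 0) -> z \notin sep (a k).
Proof.
have [|k _ [pre [sE preD]]] := @sep_form_zero a asc (size (sep (a 0))) 0.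
  by exists [::]; rewrite take_size.
exists k => z z0; rewrite sE take0 cats0; apply/negP => /preD.
exact: inv_disjoint (nodeP _) _ z0.
Qed.

Section Escape.
Variable a : nat -> tree.
Hypothesis asc : forall k, child (a k) (a k.+1).

(** Otherwise, as [G] is connected, some edge [yt] leaves the set of vertices that stay in all
    components. From some step on, [t] is outside the component but adjacent to it, so it stays in
    the separator, contrary to [sep_drops]. *)
Lemma comp_escape z : exists k, ~ comp (a k) z.
Proof.
apply: contrapT => none.
have Dz k : comp (a k) z by apply: contrapT => nD; apply: none; exists k.
pose A : set G := [set y | forall k, comp (a k) y].
have nA : ~ A (apex (a 0)) by move=> /(_ 1); apply: asc_apex_notin.
have zx : conn setT z (apex (a 0)) by apply: connected_set_conn.
have [y [t [yt _ _ Ay nAt]]] := conn_exit zx (Dz : A z) nA.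
have [k nDt] : exists k, ~ comp (a k) t.
  by apply: contrapT => h; apply: nAt => k; apply: contrapT => nD; apply: h; exists k.
have ts l : k <= l -> t \in sep (a l).
  move=> kl; apply: (inv_boundary (nodeP _) yt (Ay l)).
  by move=> /(asc_comp asc kl).
have [l drop] := sep_drops (asc_shift asc k).
have := drop t; rewrite addn0 => /(_ (ts k (leqnn k)))/negP; apply.
exact: ts (leq_addr _ _).
Qed.

(** It suffices to leave the component and the separator once: a vertex new to a separator is an
    apex, hence comes from the preceding component. *)
Lemma sep_escape z : exists k, forall l, k <= l -> ~ comp (a l) z /\ z \notin sep (a l).
Proof.
have [k nDz] := comp_escape z.
have nD l : k <= l -> ~ comp (a l) z by move=> kl /(asc_comp asc kl).
suff [j kj zj] : exists2 j, k <= j & z \notin sep (a j).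
  exists j => l jl; split; first exact/nD/(leq_trans kj).
  elim: l jl => [|l IH]; first by rewrite leqn0 => /eqP <-.
  rewrite leq_eqVlt => /predU1P[<- //|jl]; apply/negP => /(child_sep_sub (asc l)).
  rewrite in_cons (negbTE (IH jl)) orbF => /eqP zx.
  apply: (nD l); first exact: leq_trans kj jl.
  by rewrite zx; apply: asc_apex_comp.
have [zk|zk] := boolP (z \in sep (a k)); last by exists k.
have [l drop] := sep_drops (asc_shift asc k).
by exists (k + l); [apply: leq_addr|apply: drop; rewrite addn0].
Qed.

Lemma finite_escape (Y : set G) : finite_set Y ->
  exists k, forall l z, k <= l -> Y z -> ~ comp (a l) z /\ z \notin sep (a l).
Proof.
move=> /finite_seqP[s ->]; elim: s => [|y s [k IH]]; first by exists 0.
have [j jP] := sep_escape y; exists (maxn j k) => l z.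
rewrite geq_max => /andP[jl kl] /=; rewrite in_cons => /predU1P[->|zs].
  exact: jP.
exact: IH.
Qed.

End Escape.

(** * The parts and their tree-decomposition *)

Definition captures n (z : G) := comp n z /\ (internal n -> z = apex n).

(** Each vertex is captured by exactly one node, and lies in further parts only through separators
    inherited from there. *)
Definition part n : set G := [set z | z \in sep n \/ captures n z].

(** A vertex that is never captured could be followed through an infinite ascending sequence of
    components, against [comp_escape]. *)
Lemma captures_ex z : exists n, captures n z.
Proof.
apply: contrapT => none.
have [//|n Dz|a [asc Dz]] := @exists_ascending (fun n => comp n z).
  have [intn zx] : internal n /\ z <> apex n.
    split; [apply: contrapT => nint|move=> zx]; apply: none; exists n.
      by split=> // /nint.
    by split.
  have [C compC Cz] := component_ex (conj Dz zx : (comp n `\ apex n) z).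
  by have [m nm mC] := child_ex intn compC; exists m; rewrite ?mC.
by have [k] := comp_escape asc z; apply.
Qed.

Lemma captures_anc n m z : captures n z -> comp m z -> anc n m -> n = m.
Proof.
move=> [_ cap] Dm nm; apply: contrapT => neq.
have [intn sub] := anc_comp_strict nm neq.
by have [_] := sub _ Dm; apply; apply: cap.
Qed.

Lemma captures_uniq n m z : captures n z -> captures m z -> n = m.
Proof.
move=> cn cm; have [Dn Dm] := (proj1 cn, proj1 cm).
by have [/(captures_anc cn Dm)|/(captures_anc cm Dn)] := comp_laminar Dn Dm.
Qed.

Lemma part_parent n m z : child n m -> z \in sep m -> part n z.
Proof.
move=> nm /(child_sep_sub nm); have intn := child_internal nm.
rewrite in_cons => /predU1P[->|]; last by left.
by right; split=> //; apply: comp_apex.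
Qed.

Lemma part_captures n z : part n z -> exists2 m, anc m n & captures m z.
Proof.
have := root_anc depth_par n; elim=> [|{}n n0 _ IH].
  by move=> [//|c]; exists root => //; apply: anc_refl.
have cn : child (par n) n by [].
move=> [/(part_parent cn)/IH[m mn c]|c]; last by exists n => //; apply: anc_refl.
by exists m => //; apply: anc_step.
Qed.

Lemma part_decomposition : @is_tree_decomposition G tree part.
Proof.
split; first exact: ptree_is_tree.
- by move=> x; have [n c] := captures_ex x; exists n; right.
- move=> x y xy; have [[n cn] [m cm]] := (captures_ex x, captures_ex y).
  have [Dn Dm] := (proj1 cn, proj1 cm).
  have [Dny|nDny] := pselect (comp n y); last first.
    by exists n; split; [right|left; apply: (inv_boundary (nodeP n) xy)].
  have [Dmx|nDmx] := pselect (comp m x); last first.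
    exists m; split; [left|by right].
    by apply: (inv_boundary (nodeP m) _ Dm); rewrite // adj_sym.
  suff nm : n = m by exists m; split; right => //; rewrite -nm.
  by have [/(captures_anc cn Dmx)|/(captures_anc cm Dny)] := comp_laminar Dn Dmx.
move=> s p t sp tp x [Vs Vl].
(* The nodes whose parts contain [x] are descendants of the node [m] capturing [x], and with each of
   them other than [m] they include its parent. *)
have [m ms cm] := part_captures Vs.
apply: (@is_path_subtree _ _ _ _ depth_par m [set n : tree | part n x] s p)
  => // [n Vn|n Vn nm].
  by have [k kn ck] := part_captures Vn; rewrite (captures_uniq cm ck).
case: Vn => [zs|cn]; last by case: nm; apply: captures_uniq cn cm.
have n0 : n <> root by move=> n0; move: zs; rewrite n0.
exact: (part_parent (conj n0 erefl)).
Qed.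

Lemma separator_child n m : child n m ->
  separator (part : tree -> set G) [set n; m] = [set z | z \in sep m].
Proof.
move=> nm; apply/seteqP; split=> z.
  move=> V; have [//|[Dm _]] := V m (or_intror erefl).
  have [_ nx] := child_sub nm Dm.
  have [zs|[_ /(_ (child_internal nm))//]] := V n (or_introl erefl).
  case: (inv_disjoint (nodeP n) zs).
  by case: (child_sub nm Dm).
by move=> zs t [->|->]; [apply: part_parent zs|left].
Qed.

Lemma edge_child (e : set tree) : edges tree e ->
  exists n m, child n m /\ e = [set n; m].
Proof.
move=> [n [m [/ptree_adjP[nm|nm] ->]]]; first by exists n, m.
by exists m, n; rewrite setUC.
Qed.

Lemma part_connected_separators : connected_separators (part : tree -> set G).
Proof.
move=> e /edge_child[n [m [nm ->]]]; rewrite separator_child //.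
apply: sorted_connected; last exact: inv_sorted (nodeP m).
by apply: inv_top (nodeP m) _; case: nm.
Qed.

Lemma part_finite_separators : finite_separators (part : tree -> set G).
Proof.
by move=> e /edge_child[n [m [nm ->]]]; rewrite separator_child.
Qed.

Lemma part_internal_finite n : internal n -> finite_set (part n).
Proof.
move=> intn; apply: sub_finite_set (finite_seq (apex n :: sep n)).
move=> z [zs|[_ /(_ intn) ->]] /=; last exact: mem_head.
by rewrite in_cons zs orbT.
Qed.

Lemma part_meets_finite n : finite_set (part n `&` U).
Proof.
have [intn|nint] := pselect (internal n).
  by apply: sub_finite_set (part_internal_finite intn) => z [].
have finUD : finite_set (U `&` comp n).
  by apply: contrapT => inf; apply: nint; right.
have := conj (finite_seq (sep n)) finUD; rewrite -finite_setU.
apply: sub_finite_set => z [[zs|[Dz _]] Uz]; first by left.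
by right.
Qed.

Lemma not_leaf_internal n : ~ is_leaf (root : tree) n -> internal n.
Proof.
move=> nleaf; apply: contrapT => nint; apply: nleaf.
have n0 : n <> root by move=> n0; apply: nint; rewrite n0; apply: internal_root.
split=> //; exists (par n); split; first by apply/ptree_adjP; right.
by move=> m /ptree_adjP[/child_internal|[]].
Qed.

(* The edge set witnessing essential disjointness is chosen greedily along each
   branch; [used l] collects the separators chosen on the way from the root. *)
Fixpoint used (l : seq (set G)) : set G :=
  if l is C :: l' then
    let S := [set z | z \in st_sep (state_of l)] in
    if `[< S `&` used l' = set0 >] then S `|` used l' else used l'
  else set0.

Definition marked m := [set z | z \in sep m] `&` used (sval (par m)) = set0.

Lemma used_child n m : child n m -> used (sval m) =
  if `[< marked m >] then [set z | z \in sep m] `|` used (sval n)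
  else used (sval n).
Proof.
move=> nm; have [C mE] := child_sval nm.
by rewrite /marked /sep /par /= mE.
Qed.

Lemma used_finite n : finite_set (used (sval n)).
Proof.
have := root_anc depth_par n; elim=> [|m m0 _ IH]; first exact: finite_set0.
rewrite (used_child (conj m0 erefl)); case: ifP => // _.
by rewrite finite_setU; split.
Qed.

Lemma used_anc n m : anc n m -> used (sval n) `<=` used (sval m).
Proof.
elim=> [//|{}m m0 _ IH] z /IH; rewrite (used_child (conj m0 erefl)).
by case: ifP => // _; right.
Qed.

Lemma marked_used n m : child n m -> marked m ->
  [set z | z \in sep m] `<=` used (sval m).
Proof.
by move=> nm mm z zs; rewrite (used_child nm); case: asboolP => // _; left.
Qed.

(** If no later separator were chosen, [used] would remain a fixed finite set. The separators
    eventually avoid it, and then one is chosen. *)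
Lemma asc_marked (a : nat -> tree) (asc : forall k, child (a k) (a k.+1)) k :
  exists2 l, k <= l & marked (a l.+1).
Proof.
apply: contrapT => none.
have const l : k <= l -> used (sval (a l)) = used (sval (a k)).
  elim: l => [|l IH]; first by rewrite leqn0 => /eqP ->.
  rewrite leq_eqVlt => /predU1P[<- //|kl].
  rewrite (used_child (asc l)) IH //; case: asboolP => // ml.
  by case: none; exists l.
have [j jP] := finite_escape asc (used_finite (a k)).
apply: none; exists (maxn j k); first exact: leq_maxr.
have [_ parE] := asc (maxn j k).
rewrite /marked parE const ?leq_maxr //; apply/seteqP; split=> // z [zs uz].
have [_] := jP (maxn j k).+1 z (leqW (leq_maxl _ _)) uz.
by rewrite [z \in _]zs.
Qed.

Lemma ray_edge_inj (T : graph) (R : ray T) :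
  injective (fun k => [set R k; R k.+1]).
Proof.
have aux k l : [set R k; R k.+1] = [set R l; R l.+1] -> l <= k.
  by move=> /seteqP[+ _] => /(_ (R k) (or_introl erefl)) -[] /ray_inj -> //.
by move=> k l kl; apply/eqP; rewrite eqn_leq !aux.
Qed.

Lemma part_essentially_disjoint :
  essentially_disjoint (part : tree -> set G) (root : tree).
Proof.
exists [set e | exists n m, [/\ child n m, marked m & e = [set n; m]]].
split=> [e [n [m [nm _ ->]]]|R|e f p].
- by exists n, m; split=> //; apply/ptree_adjP; left.
- move=> /(finite_preimage (f := fun k => [set R k; R k.+1])) fin.
  have [k l _ _|N bound] := finite_nat_bound (fin _); first exact: ray_edge_inj.
  have [K asc] := ray_ascends R.
  have asc' k : child (R (maxn K N + k)) (R (maxn K N + k.+1)).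
    rewrite addnS; apply: asc; apply: leq_trans (leq_addr _ _).
    exact: leq_maxl.
  have [l _ ml] := asc_marked asc' 0.
  have := bound (maxn K N + l); rewrite ltnNge => /(_ _)/negP[].
    split; last by exists (maxn K N + l).
    exists (R (maxn K N + l)), (R (maxn K N + l).+1); split=> //.
      by have := asc' l; rewrite addnS.
    by rewrite -addnS.
  by apply: leq_trans (leq_addr _ _); apply: leq_maxr.
move=> [n [m [nm mm eE]]] [n' [m' [nm' mm' fE]]] neq rp fl pe.
have mp : (m : tree) \in (root : tree) :: p.
  by apply: path_edges_mem pe _; rewrite eE; right.
have m0 : m <> root by case: nm.
have ml : anc m (last (root : tree) p).
  have [mr|//] := is_path_anc rp mp.
  by case: m0; apply: anc_antisym depth_par _ _ mr (root_anc depth_par m).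
have mm'' : anc m m'.
  move: fl; rewrite fE => -[ln|<- //]; apply: anc_trans _ (child_anc nm').
  by rewrite -ln.
(* Since [m] is a proper ancestor of [m'], its separator was already in the set against which that
   of [m'] was tested. *)
have mn' : anc m n'.
  have [_ <-] := nm'; apply: anc_par mm'' _ => mE; apply: neq.
  by have [[_ nE] [_ n'E]] := (nm, nm'); rewrite eE fE -nE -n'E mE.
rewrite eE fE !separator_child //; apply/seteqP; split=> // z [zm zm'].
have : marked m' by []. rewrite /marked; case: nm' => _ -> /seteqP[+ _].
by apply; split; [exact: zm'|apply: (used_anc mn'); apply: marked_used nm mm _ zm].
Qed.

(** * Ends of [G] and ends of the tree *)

Section Ends.
Implicit Types (w : graph_end G) (h : graph_end tree).

Notation tree_ray asc := (@asc_ray _ _ _ _ depth_par _ asc).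

Notation tree_depth asc := (@asc_depth _ _ _ _ depth_par _ asc).

Definition end_in w n := forall R, in_end w R -> has_tail_in R (comp n).

Lemma end_in_ray w n R : in_end w R -> has_tail_in R (comp n) -> end_in w n.
Proof.
move=> wR tail R' wR'.
exact: end_side (finite_seq (sep n)) (inv_boundary (nodeP n)) wR wR' tail.
Qed.

Lemma end_not_in w n R : ~ end_in w n -> in_end w R ->
  has_tail_in R (~` comp n).
Proof.
move=> nin wR.
have [tail|//] := ray_side R (finite_seq (sep n)) (inv_boundary (nodeP n)).
by case: nin; apply: end_in_ray tail.
Qed.

Lemma end_in_anc w n m : anc n m -> end_in w m -> end_in w n.
Proof. by move=> nm win R /win; apply: has_tail_sub; apply: anc_comp. Qed.

Lemma end_in_common w n m : end_in w n -> end_in w m ->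
  exists z, comp n z /\ comp m z.
Proof.
move=> wn wm; have [R wR] := graph_end_ray w.
have [z [Dn Dm]] := has_tail_ex (has_tailI (wn R wR) (wm R wR)).
by exists z.
Qed.

Lemma end_in_laminar w n m : end_in w n -> end_in w m -> anc n m \/ anc m n.
Proof.
by move=> wn wm; have [z [Dn Dm]] := end_in_common wn wm; apply: comp_laminar Dn Dm.
Qed.

Lemma end_in_depth w n m : end_in w n -> end_in w m -> depth n = depth m -> n = m.
Proof.
by move=> wn wm nm; have [z [Dn Dm]] := end_in_common wn wm;
  apply: same_depth nm Dn Dm.
Qed.

Lemma end_in_root w : end_in w root.
Proof. by move=> R _; exists 0. Qed.

(** A vertex of [comp m] is captured in the subtree of [m]: its capturing node is comparable with
    [m] and cannot be a proper ancestor, since a captured vertex enters no later component. *)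
Lemma oriented_up w n m : child n m -> end_in w m ->
  oriented (part : tree -> set G) w n m.
Proof.
move=> nm wm R /wm; apply: has_tail_sub => z Dm.
rewrite separator_child //; split; last first.
  by move=> /(inv_disjoint (nodeP m)).
have [t ct] := captures_ex z; exists t; last by right.
have [m0 <-] := nm; apply/(branch_anc _ m0).
have [//|tm] := comp_laminar Dm (proj1 ct).
by rewrite (captures_anc ct Dm tm); apply: anc_refl.
Qed.

Lemma oriented_down w n m : child n m -> ~ end_in w m ->
  oriented (part : tree -> set G) w m n.
Proof.
move=> nm wm R wR.
have := has_tailI (end_not_in wm wR) (has_tail_compl R (finite_seq (sep m))).
apply: has_tail_sub => z [nDm nSm]; rewrite setUC separator_child //; split=> //.
have [t ct] := captures_ex z; exists t; last by right.
have [m0 <-] := nm; apply/(branch_not_anc _ m0) => mt.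
by apply: nDm; apply: anc_comp mt _ (proj1 ct).
Qed.

Definition home w t := end_in w t /\ forall c, child t c -> ~ end_in w c.

Lemma home_lives_at w t : home w t -> lives_at (part : tree -> set G) w t.
Proof.
move=> [wt noc] t1 t2 /ptree_adjP[nm|nm].
  have [t20 <-] := nm => /(branch_anc _ t20) t2t.
  case: nm => _ parE; rewrite parE; apply: oriented_up; first by split.
  exact: end_in_anc t2t wt.
have [t10 <-] := nm => /(branch_not_anc _ t10) nt1t.
apply: oriented_down => // wt1.
have [tt1|//] := end_in_laminar wt wt1.
have [tE|neq] := pselect (t = t1).
  by apply: nt1t; rewrite tE; apply: anc_refl.
have [c tc ct1] := anc_child tt1 neq.
by apply: (noc c tc); apply: end_in_anc ct1 wt1.
Qed.

(** If [t] is not internal, [comp t] is too poor in vertices of [U] for such a comb. If it is, a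
    tail of the spine avoids the apex and so lies in the component of some child. *)
Lemma home_not_closure w t : home w t -> ~ in_closure U w.
Proof.
move=> [wt noc] [C [attC wC]].
have tail := wt _ wC.
have [intt|nint] := pselect (internal t); last first.
  apply: nint; right.
  exact: comb_closure (finite_seq (sep t)) (inv_boundary (nodeP t)) tail attC.
have [N sub] := has_tailI tail (has_tail_compl _ (finite_set1 (apex t))).
have [D compD DN] := component_ex (sub N (leqnn N)).
have [c tc cD] := child_ex intt compD.
apply: (noc c tc); apply: end_in_ray wC _; rewrite cD; exists N => k Nk.
by apply: (component_closed compD DN); apply: (ray_conn_tail sub).
Qed.

Definition tracks w (a : nat -> tree) := forall k, end_in w (a k).

Lemma tracks_corresponds w (a : nat -> tree) (asc : forall k, child (a k) (a k.+1)) :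
  tracks w a -> corresponds_to (part : tree -> set G) w (end_of (tree_ray asc)).
Proof.
move=> wa t1 t2 /ptree_adjP[nm|nm] /(_ _ (in_end_of _)) [N tail].
  have := tail N (leqnn N); have [t20 parE] := nm.
  rewrite -{1}parE => /(branch_anc _ t20) t2a.
  by apply: oriented_up => //; apply: end_in_anc t2a (wa N).
apply: oriented_down => // wt1.
have [t10 parE] := nm.
have := tail (maxn N (depth t1)) (leq_maxl _ _).
rewrite -parE => /(branch_not_anc _ t10); apply.
have [//|at1] := end_in_laminar wt1 (wa (maxn N (depth t1))).
rewrite /= (anc_depth_eq depth_par at1); first exact: anc_refl.
rewrite /= (tree_depth asc); apply: leq_trans (leq_addl _ _).
exact: leq_maxr.
Qed.

(** Far enough out, [comp (a k)] avoids a given finite set. It is connected and contains tails of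
    both rays. *)
Lemma tracks_apex_ray w (a : nat -> tree) (asc : forall k, child (a k) (a k.+1)) :
  tracks w a -> in_end w (apex_ray asc).
Proof.
move=> wa; have [R wR] := graph_end_ray w; apply/(in_end_equiv _ wR).
apply/ray_equivP => S /(finite_escape asc)[k av].
have [N tail] := wa k R wR; exists N, k.
apply: conn_sub (connected_set_conn (inv_conn (nodeP (a k))) (tail N (leqnn N)) _).
  by move=> z Dz Sz; have [] := av k z (leqnn k) Sz.
exact: asc_apex_comp.
Qed.

Lemma tracks_closure w (a : nat -> tree) (asc : forall k, child (a k) (a k.+1)) :
  tracks w a -> in_closure U w.
Proof.
move=> wa; exists (asc_comb asc); split; first exact: asc_comb_attached.
exact: tracks_apex_ray.
Qed.

Lemma apex_end_tracks (a : nat -> tree) (asc : forall k, child (a k) (a k.+1)) :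
  tracks (end_of (apex_ray asc)) a.
Proof. by move=> k; apply: end_in_ray (in_end_of _) (apex_ray_tail asc k). Qed.

(** The map [tau] as a relation, from which choice extracts it. An end of the tree comes with a ray
    in it that ascends from its first node. *)
Definition end_image w (y : graph_end tree + tree) : Prop :=
  match y with
  | inl h => exists a (asc : forall k, child (a k) (a k.+1)),
      h = end_of (tree_ray asc) /\ tracks w a
  | inr t => home w t
  end.

Lemma end_image_ex w : exists y, end_image w y.
Proof.
have [[t ht]|none] := pselect (exists t, home w t); first by exists (inr t).
have [|n wn|a [asc wa]] := @exists_ascending (end_in w).
- exact: end_in_root.
- apply: contrapT => noc; apply: none; exists n; split=> // c nc wc.
  by apply: noc; exists c.
by exists (inl (end_of (tree_ray asc))), a, asc.
Qed.

(** The ray [b] has a tail in the subtree of every [a k]. Hence two ends of [G] with the same image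
    track the same sequence, which gives injectivity of [tau]. *)
Lemma asc_end_tracks w (a b : nat -> tree)
    (asc : forall k, child (a k) (a k.+1)) (bsc : forall k, child (b k) (b k.+1)) :
  ray_equiv (tree_ray asc) (tree_ray bsc) ->
  tracks w b -> tracks w a.
Proof.
move=> ab wb k.
have bd : @outer_boundary tree (anc (a k)) [set par (a k)].
  by move=> x y xy ax nay; have [_ ->] := anc_exit xy ax nay.
have tail : has_tail_in (tree_ray asc) (anc (a k)).
  by exists k => l kl; apply: asc_anc.
have [N btail] := ray_equiv_side (finite_set1 _) bd ab tail.
exact: end_in_anc (btail N (leqnn N)) (wb N).
Qed.

Lemma part_displays : displays (part : tree -> set G) (in_closure U).
Proof.
split; first exact: part_finite_separators.
have [tau tauP] := choice end_image_ex.
exists tau; split.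
- move=> w; have := tauP w; case: (tau w) => [h [a [asc [-> wa]]]|t].
    exact: tracks_corresponds.
  exact: home_lives_at.
- split.
  + move=> w clw; have := tauP w; case: (tau w) => [h _|t ht]; first by exists h.
    by case: (home_not_closure ht clw).
  + move=> w w'; rewrite !inE => clw clw' tauE.
    have := tauP w; have := tauP w'; rewrite -tauE.
    case: (tau w) => [h|t _ /home_not_closure //].
    move=> [b [bsc [-> wb]]] [a [asc [hE wa]]].
    have ea : in_end (end_of (tree_ray bsc)) (tree_ray asc).
      by rewrite hE; apply: in_end_of.
    have ab := in_end_ray_equiv ea (in_end_of (tree_ray bsc)).
    apply: (graph_end_eq (tracks_apex_ray asc wa)).
    by apply: tracks_apex_ray; apply: asc_end_tracks ab wb.
  (* Surjectivity: a tail of a ray in [h] ascends, and the end of its apex ray tracks it. *)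
  move=> _ [h _ <-]; have [R hR] := graph_end_ray h.
  have [K asc'] := ray_ascends R.
  pose a k : tree := R (K + k).
  have asc k : child (a k) (a k.+1).
    by rewrite /a addnS; apply: asc'; apply: leq_addr.
  have wa := @apex_end_tracks a asc.
  have clw := tracks_closure asc wa.
  exists (end_of (apex_ray asc)) => //.
  have := tauP (end_of (apex_ray asc)).
  case: (tau _) => [h' [b [bsc [-> wb]]]|t ht]; last first.
    by case: (home_not_closure ht clw).
  congr inl; apply: (graph_end_eq (in_end_of _)); apply/(in_end_equiv _ hR).
  apply/ray_equiv_sym/ray_equiv_meet => N.
  (* The two nodes have equal depth and are tracked by the same end, so they coincide. Choosing the
     first index at least [depth (a 0)] makes the truncated subtraction exact. *)
  exists (maxn N (depth (a 0))), (K + (depth (b (maxn N (depth (a 0)))) - depth (a 0))).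
  split; first exact: leq_maxl.
  apply: (end_in_depth (wb _) (wa _)).
  rewrite [RHS](tree_depth asc) subnKC // (tree_depth bsc).
  by apply: leq_trans (leq_addl _ _); apply: leq_maxr.
move=> w nclw; have := tauP w.
case: (tau w) => [h [a [asc [_ wa]]]|t _]; last by exists t.
by case: nclw; apply: tracks_closure asc wa.
Qed.

End Ends.

End Construction.

(** * The dichotomy *)

Theorem theorem2 (G : graph) (hG : connected_graph G) (U : set G) :
  let dominated_comb := exists C : comb G, attached C U /\ dominated C in
  let decomposition :=
    exists (T : graph) (r : T) (V : T -> set G),
      [/\ is_tree_decomposition V,
          forall t, finite_set (V t `&` U),
          forall t, ~ is_leaf r t -> finite_set (V t),
          essentially_disjoint V r /\ connected_separators V
        & displays V (in_closure U)] in
  (dominated_comb \/ decomposition) /\ ~ (dominated_comb /\ decomposition).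
Proof.
move=> dominated_comb decomposition; split; last first.
  move=> [[C [attC domC]] [T [r [V [tdV _ _ [esV _] disV]]]]].
  exact: dominated_comb_no_decomposition attC domC tdV esV disV.
have [|nodom] := pselect dominated_comb; [by left|right].
have [[v0 _] _] := hG.
exists (ptree (@depth_par G U v0)), (root U v0), (part (v0 := v0)); split.
- exact: part_decomposition hG nodom.
- exact: part_meets_finite.
- by move=> t /not_leaf_internal; apply: part_internal_finite.
- split; last exact: part_connected_separators hG.
  exact: part_essentially_disjoint hG nodom.
exact: part_displays hG nodom.
Qed.
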